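(* (Geometric integral representation of the failure energy.) Let $$\mathcal{F}^\epsilon(t)=\int_\Omega\int_\Omega\rho^\epsilon(\mathbf{y},\mathbf{x})\,C^+\,\chi^+(\mathbf{y},\mathbf{x},t)\,d\mathbf{y}\,d\mathbf{x}$$ be the failure energy associated with the failure set $\Gamma^\epsilon(t)$, where $\chi^+(\mathbf{y},\mathbf{x},t)=1$ if $(\mathbf{x},\mathbf{y})\in\Gamma^\epsilon(t)$ and $0$ otherwise. Then $$\mathcal{F}^\epsilon(t)=\frac{C^+}{\omega_d}\int_{\mathbb{S}^{d-1}}\int_{\Omega^{\mathbf{e}}}\int_0^1 J(q)\,q^d\,m^\epsilon(t,\mathbf{e},\mathbf{z},q)\,dq\,d\mathbf{z}\,d\mathbf{e},$$ where $$m^\epsilon(t,\mathbf{e},\mathbf{z},q)=\frac{1}{\epsilon q}\int_{\Omega^{\mathbf{e}}_{\mathbf{z}}}\chi^+(\mathbf{z}+\mathbf{e}(s+\epsilon q),\mathbf{z}+\mathbf{e}s,t)\,ds .$$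
   Context: Let $d\in\{2,3\}$, $\Omega\subset\mathbb{R}^d$ a bounded domain, $\epsilon>0$, $C^+>0$ a constant (the asymptotic value $g(r^+)$ of the bond potential). $H_\epsilon(\mathbf{x})=\{\mathbf{y}:|\mathbf{y}-\mathbf{x}|<\epsilon\}$; $\omega_d$ is the volume of the unit ball in $\mathbb{R}^d$; $V_d^\epsilon=\omega_d\epsilon^d$. The kernel is $\rho^\epsilon(\mathbf{y},\mathbf{x})=\chi_\Omega(\mathbf{y})J(|\mathbf{y}-\mathbf{x}|/\epsilon)/(\epsilon V_d^\epsilon)$, where $J:[0,\infty)\to[0,\infty)$ is decreasing, positive on $[0,1)$, $J(0)=M<\infty$, $J=0$ on $[1,\infty)$. Failure set: $\Gamma^\epsilon(t)=\{(\mathbf{x},\mathbf{y})\in\Omega\times(\Omega\cap H_\epsilon(\mathbf{x})):\gamma(\mathbf{u})(\mathbf{y},\mathbf{x},t)=0\}$, where $\gamma(\mathbf{u})(\mathbf{y},\mathbf{x},t)$ is the degradation factor of the bond between $\mathbf{x}$ and $\mathbf{y}$ at time $t$: a measurable function of $(\mathbf{y},\mathbf{x})$ with values in $[0,1]$, symmetric in $(\mathbf{x},\mathbf{y})$. For the claim only the measurability and symmetry of $\Gamma^\epsilon(t)$ are relevant. For the model, with $\mathbf{u}$ a displacement field that is a continuous function of $t\in[0,T]$ with values in $L^\infty(\Omega;\mathbb{R}^d)$, $S(\mathbf{y},\mathbf{x},\mathbf{u}(t))=\frac{\mathbf{u}(t,\mathbf{y})-\mathbf{u}(t,\mathbf{x})}{|\mathbf{y}-\mathbf{x}|}\cdot\frac{\mathbf{y}-\mathbf{x}}{|\mathbf{y}-\mathbf{x}|}$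 and $r=\sqrt{|\mathbf{y}-\mathbf{x}|}\,S$, $\gamma$ is either (a) $h(\int_0^t(r(\tau,\mathbf{u})-r^+)^+d\tau)$ with $h\ge0$ smooth, equal to $1$ for negative arguments, decreasing to zero on $[0,x^D)$, zero on $[x^D,\infty)$, or (b) $h(\sqrt{|\mathbf{y}-\mathbf{x}|}\max_{0\le\tau\le t}S(\mathbf{y},\mathbf{x},\mathbf{u}(\tau)))$ with $h\ge0$ smooth, equal to $1$ on $(-\infty,r^+]$, decreasing to zero on $[r^+,r^D]$, zero on $[r^D,\infty)$; here $x^D>0$ and $0<r^+<r^D$. Slicing: for $\mathbf{e}\in\mathbb{S}^{d-1}$ and $\mathbf{z}\in\mathbf{e}^\perp$ (the $(d-1)$-dimensional subspace orthogonal to $\mathbf{e}$), $\Omega^{\mathbf{e}}_{\mathbf{z}}=\{s\in\mathbb{R}:\mathbf{z}+\mathbf{e}s\in\Omega\}$ and $\Omega^{\mathbf{e}}=\{\mathbf{z}\in\mathbf{e}^\perp:\Omega^{\mathbf{e}}_{\mathbf{z}}\neq\emptyset\}$. $d\mathbf{z}$ is $(d-1)$-dimensional Lebesgue measure on $\mathbf{e}^\perp$ and $d\mathbf{e}$ is surface measure on $\mathbb{S}^{d-1}$. $\chi^+=0$ for pairs not in $\Gamma^\epsilon(t)$, in particular when one of the points is outside $\Omega$. *)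

(* Defs.v *)
From HB Require Import structures.
From mathcomp Require Import all_boot all_order all_algebra.
From mathcomp Require Import all_classical all_reals all_analysis.
From mathcomp Require Import measurable_realfun ring.

Set Implicit Arguments.
Unset Strict Implicit.
Unset Printing Implicit Defensive.

Import Order.TTheory GRing.Theory Num.Theory.
Import numFieldNormedType.Exports.

Local Open Scope classical_set_scope.
Local Open Scope ring_scope.

(* The library norm on 'rV[R]_n is the sup norm, hence the explicit Euclidean
   scalar product and norm.  Topological notions (open, connected, bounded) are
   the same for both norms, and the library ones are used. *)
Section euclidean.
Context {R : realType}.

Definition dot n (u v : 'rV[R]_n) : R := (u *m v^T) 0 0.
Definition enorm n (u : 'rV[R]_n) : R := Num.sqrt (dot u u).
Definition eball n (x : 'rV[R]_n) (r : R) : set 'rV[R]_n :=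
  [set y | enorm (y - x) < r].
Definition esphere n : set 'rV[R]_n := [set e | enorm e = 1].

Lemma dotE n (u v : 'rV[R]_n) : dot u v = \sum_(i < n) u 0 i * v 0 i.
Proof. by rewrite /dot mxE; apply: eq_bigr => i _; rewrite mxE. Qed.

End euclidean.

(* Borel sigma-algebra of R^n, as the product sigma-algebra: it is generated by
   the coordinates, like the library's sigma-algebra on n.-tuple T. *)
Section measurable_rV.
Context {R : realType} (n : nat).

Definition coord_rV (i : 'I_n) (v : 'rV[R]_n) : measurableTypeR R := v 0 i.

Let rV_set0 : g_sigma_preimage coord_rV set0.
Proof. exact: sigma_algebra0. Qed.

Let rV_setC A : g_sigma_preimage coord_rV A -> g_sigma_preimage coord_rV (~` A).
Proof. exact: sigma_algebraC. Qed.

Let rV_bigcup (F : (set 'rV[R]_n)^nat) :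
  (forall i, g_sigma_preimage coord_rV (F i)) ->
  g_sigma_preimage coord_rV (\bigcup_i (F i)).
Proof. exact: sigma_algebra_bigcup. Qed.

HB.instance Definition _ :=
  @isMeasurable.Build (measure_tuple_display default_measure_display)
    'rV[R]_n (g_sigma_preimage coord_rV) rV_set0 rV_setC rV_bigcup.

Lemma measurable_coord_rV (i : 'I_n) : measurable_fun setT (coord_rV i).
Proof.
move=> _ Y mY; rewrite setTI; apply: sub_sigma_algebra => /=.
rewrite -bigcup_seq/=; exists i => /=; first by rewrite mem_index_enum.
by exists Y => //; rewrite setTI.
Qed.

Lemma measurable_fun_rV d (T : measurableType d) (f : T -> 'rV[R]_n) :
  (forall i, measurable_fun setT (coord_rV i \o f)) -> measurable_fun setT f.
Proof.
move=> mf _ B mB; rewrite setTI.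
pose S := [set A : set 'rV[R]_n | measurable (f @^-1` A)].
suff h : @measurable _ 'rV[R]_n `<=` S by exact: h.
apply: smallest_sub.
  split => [|A SA|F SF]; rewrite /S /=.
  - by rewrite preimage_set0.
  - by rewrite setTD preimage_setC; exact: measurableC.
  - by rewrite preimage_bigcup; apply: bigcupT_measurable => k; exact: SF.
move=> A; rewrite -bigcup_seq/= => -[i _] [C mC <-]; rewrite /S /= setTI.
by have := mf i measurableT C mC; rewrite setTI.
Qed.

End measurable_rV.

Section lebesgue_rV.
Context {R : realType}.

Definition cons_rV n (p : measurableTypeR R * 'rV[R]_n) : 'rV[R]_n.+1 :=
  row_mx (const_mx p.1 : 'rV[R]_1) p.2.

Lemma cons_rV0 n p : @cons_rV n p 0 ord0 = p.1.
Proof.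
rewrite /cons_rV (_ : ord0 = lshift n (ord0 : 'I_1)); last exact/val_inj.
by rewrite (row_mxEl (const_mx p.1 : 'rV[R]_1)) mxE.
Qed.

Lemma cons_rVS n p i : @cons_rV n p 0 (lift ord0 i) = p.2 0 i.
Proof.
rewrite /cons_rV (_ : lift ord0 i = rshift 1 i); last exact/val_inj.
by rewrite (row_mxEr (const_mx p.1 : 'rV[R]_1)).
Qed.

Lemma measurable_cons_rV n : measurable_fun setT (@cons_rV n).
Proof.
apply: measurable_fun_rV => i.
case: (unliftP ord0 i) => [j ->|->].
- rewrite (_ : _ \o _ = coord_rV j \o snd).
    by apply: measurableT_comp; [exact: measurable_coord_rV|exact: measurable_snd].
  by apply/funext => p; rewrite /coord_rV /= cons_rVS.
- rewrite (_ : _ \o _ = fst); first exact: measurable_fst.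
  by apply/funext => p; rewrite /coord_rV /= cons_rV0.
Qed.

Definition push d1 d2 (T1 : measurableType d1) (T2 : measurableType d2)
    (f : T1 -> T2) (mf : measurable_fun setT f)
    (mu : {measure set T1 -> \bar R}) : set T2 -> \bar R :=
  pushforward mu f.

Section push_measure.
Context d1 d2 (T1 : measurableType d1) (T2 : measurableType d2)
  (f : T1 -> T2) (mf : measurable_fun setT f) (mu : {measure set T1 -> \bar R}).

Let push0 : push mf mu set0 = 0%E. Proof. exact: measure0. Qed.
Let push_ge0 A : (0 <= push mf mu A)%E. Proof. exact: measure_ge0. Qed.
Let push_sigma_additive : semi_sigma_additive (push mf mu).
Proof. exact: measure_semi_sigma_additive. Qed.

HB.instance Definition _ := isMeasure.Build _ _ _ (push mf mu)
  push0 push_ge0 push_sigma_additive.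

End push_measure.

(* n-dimensional Lebesgue measure, as an iterated product measure on R x R^n.
   The variant \x^ of the product is the one that only needs its left factor to
   be sigma-finite. *)
Fixpoint lebesgue_rV_rec n : {measure set 'rV[R]_n -> \bar R} :=
  if n is m.+1 then
    push (@measurable_cons_rV m) (lebesgue_measure \x^ lebesgue_rV_rec m)%E
  else dirac (0 : 'rV[R]_0).

Definition lebesgue_rV n : set 'rV[R]_n -> \bar R := lebesgue_rV_rec n.
HB.instance Definition _ n := Measure.on (@lebesgue_rV n).

Let cube n (k : nat) : set 'rV[R]_n := [set v | forall i, `|v 0 i| <= k%:R].

Let cube_rec n k :
  @cons_rV n @^-1` (@cube n.+1 k) = `[- k%:R, k%:R] `*` @cube n k.
Proof.
apply/seteqP; split => -[x v] /=; rewrite in_itv /= -ler_norml => h.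
  split; first by have := h ord0; rewrite cons_rV0.
  by move=> i; have := h (lift ord0 i); rewrite cons_rVS.
case: h => h1 h2 i; case: (unliftP ord0 i) => [j ->|->].
  by rewrite cons_rVS; exact: h2.
by rewrite cons_rV0.
Qed.

Let measurable_cube n k : measurable (@cube n k).
Proof.
rewrite (_ : @cube n k = \bigcap_(i in [set: 'I_n])
    (@coord_rV R n i @^-1` `[- k%:R, k%:R])).
  apply: fin_bigcap_measurable => // i _.
  by rewrite -[X in measurable X]setTI; exact: measurable_coord_rV.
apply/seteqP; split => v /= h i.
  by move=> _; rewrite /= in_itv /= -ler_norml; exact: h.
by have := h i I; rewrite /= in_itv /= -ler_norml.
Qed.

Let lebesgue_cube_fin n k : (lebesgue_rV (@cube n k) < +oo)%E.
Proof.
elim: n => [|n ih]; first by rewrite /lebesgue_rV /= diracE ltry.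
rewrite /lebesgue_rV /= /push /pushforward cube_rec.
rewrite product_measure2E//=; last exact: measurable_cube.
rewrite lte_mul_pinfty ?measure_ge0 //.
  by rewrite lebesgue_measure_itv /=; case: ifP.
Qed.

Let lebesgue_rV_sigma_finite n : sigma_finite setT (@lebesgue_rV n).
Proof.
exists (@cube n) => [|k]; last first.
  by split; [exact: measurable_cube|exact: lebesgue_cube_fin].
apply/esym/seteqP; split => // v _.
pose m := \sum_(i < n) `|v 0 i|.
have [k mk] : exists k : nat, m <= k%:R.
  exists (Num.truncn m).+1; apply/ltW/truncnS_gt.
exists k => // i; apply: le_trans mk.
by rewrite /m (bigD1 i) //= lerDl sumr_ge0.
Qed.

HB.instance Definition _ n := @Measure_isSigmaFinite.Build _ _ _
  (@lebesgue_rV n) (@lebesgue_rV_sigma_finite n).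

End lebesgue_rV.
Arguments lebesgue_rV {R} n.

(* Surface measure on the unit sphere of R^(n+1), through the area formula for
   graphs: off the null equator, the sphere is the union of the graphs of f and
   -f over the unit ball of R^n, where f w = sqrt (1 - |w|^2), and the area
   element is sqrt (1 + |grad f w|^2) = 1 / sqrt (1 - |w|^2).  The latter
   expression evaluates to 0 for |w| >= 1, so that integrating it over R^n
   amounts to integrating over the open unit ball. *)
Section sphere_measure.
Context {R : realType}.

Definition area_element n (w : 'rV[R]_n) : R := (Num.sqrt (1 - dot w w))^-1.

Definition upper_graph n (w : 'rV[R]_n) : 'rV[R]_n.+1 :=
  cons_rV (Num.sqrt (1 - dot w w), w).

Definition lower_graph n (w : 'rV[R]_n) : 'rV[R]_n.+1 :=
  cons_rV (- Num.sqrt (1 - dot w w), w).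

Let height n (w : 'rV[R]_n) : measurableTypeR R := Num.sqrt (1 - dot w w).

Let measurable_height n : measurable_fun setT (@height n).
Proof.
have ms : measurable_fun setT
    (@Num.sqrt R : measurableTypeR R -> measurableTypeR R).
  apply: continuous_measurable_fun.
  exact: sqrt_continuous.
apply: (measurableT_comp ms).
apply: measurable_funB => //.
rewrite (_ : (fun w : 'rV[R]_n => dot w w) =
    (fun w => \sum_(i < n) (coord_rV i w * coord_rV i w : R))).
  by apply: measurable_sum => i; apply: measurable_funM;
    exact: measurable_coord_rV.
by apply/funext => w; rewrite dotE.
Qed.

Let measurable_area_element n : measurable_fun setT (@area_element n).
Proof.
rewrite (_ : @area_element n = (fun x : R => x `^ (-1)) \o @height n).
  apply: measurableT_comp; first exact: measurable_powR.
  exact: measurable_height.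
by apply/funext => w; rewrite /= powR_inv1// sqrtr_ge0.
Qed.

Lemma measurable_upper_graph n : measurable_fun setT (@upper_graph n).
Proof.
apply: measurableT_comp; first exact: measurable_cons_rV.
by apply: measurable_fun_pair => //; exact: measurable_height.
Qed.

Lemma measurable_lower_graph n : measurable_fun setT (@lower_graph n).
Proof.
apply: measurableT_comp; first exact: measurable_cons_rV.
apply: measurable_fun_pair => //.
by apply: (@measurableT_comp _ _ _ _ _ _ (@GRing.opp R)) => //;
  exact: measurable_height.
Qed.

Definition area_measure n (V : set 'rV[R]_n) : \bar R :=
  (\int[lebesgue_rV n]_(w in V) (area_element w)%:E)%E.

Let area0 n : @area_measure n set0 = 0%E.
Proof. by rewrite /area_measure integral_set0. Qed.

Let area_ge0 n V : (0 <= @area_measure n V)%E.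
Proof. by apply: integral_ge0 => w _; rewrite lee_fin invr_ge0 sqrtr_ge0. Qed.

Let area_sigma_additive n : semi_sigma_additive (@area_measure n).
Proof.
apply: semi_sigma_additive_nng_induced => [|w].
  by apply/measurable_EFinP; exact: measurable_area_element.
by rewrite lee_fin invr_ge0 sqrtr_ge0.
Qed.

HB.instance Definition _ n := isMeasure.Build _ _ _ (@area_measure n)
  (@area0 n) (@area_ge0 n) (@area_sigma_additive n).

Definition sphere_measure n : set 'rV[R]_n.+1 -> \bar R :=
  measure_add (push (@measurable_upper_graph n) (@area_measure n))
              (push (@measurable_lower_graph n) (@area_measure n)).

HB.instance Definition _ n := Measure.on (@sphere_measure n).

End sphere_measure.
Arguments sphere_measure {R} n.

(* n-dimensional Lebesgue measure on the hyperplane orthogonal to a unit vector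
   e of R^(n+1): the image of Lebesgue measure on R^n under the linear isometry
   w |-> \sum_i w_i b_i given by an orthonormal basis (b_i) of the hyperplane,
   the rows of a matrix.  The measure does not depend on the chosen basis. *)
Section lebesgue_perp.
Context {R : realType} (n : nat).

Definition perp_basis (e : 'rV[R]_n.+1) (B : 'M[R]_(n, n.+1)) : Prop :=
  B *m B^T = 1%:M /\ B *m e^T = 0.

Definition perp_frame (e : 'rV[R]_n.+1) : 'M[R]_(n, n.+1) :=
  xget 0 [set B | perp_basis e B].

Lemma perp_basis_exists (e : 'rV[R]_n.+1) : esphere e ->
  exists B, perp_basis e B.
Proof.
move=> e1.
have ee : e *m e^T = 1%:M.
  apply/matrixP => i j; rewrite !ord1 [RHS]mxE eqxx -/(dot e e).
  move: e1; rewrite /esphere /enorm /= => e1.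
  rewrite -[LHS]sqr_sqrtr ?e1 ?expr1n// dotE sumr_ge0// => k _.
  by rewrite -expr2 sqr_ge0.
pose a : 'rV[R]_n.+1 := delta_mx 0 0.
have aa : a *m a^T = 1%:M.
  rewrite trmx_delta mul_delta_mx; apply/matrixP => i j.
  by rewrite !ord1 !mxE !eqxx.
suff [H [HH He]] : exists H : 'M[R]_n.+1, H *m H^T = 1%:M /\ H *m e^T = a^T.
  exists (rowsub (lift ord0) H); split.
    rewrite trmx_mxsub -mxsub_mul HH; apply/matrixP => i j.
    by rewrite !mxE (inj_eq lift_inj).
  rewrite mul_rowsub_mx He; apply/matrixP => i j.
  have /negbTE l0 : lift ord0 i != 0 :> 'I_n.+1 by rewrite eq_sym neq_lift.
  by rewrite !mxE l0 andbF.
have [->|ea] := eqVneq e a.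
  by exists 1%:M; rewrite trmx1 mulmx1 mul1mx.
pose v := e - a; pose s : R := dot e a.
have mx11 (M : 'M[R]_1) : M = (M 0 0)%:M by rewrite [LHS]mx11_scalar.
have ea' : e *m a^T = s%:M by rewrite [LHS]mx11.
have ae : a *m e^T = s%:M by rewrite -[LHS]trmxK trmx_mul trmxK ea' tr_scalar_mx.
have vv : v *m v^T = (2 - 2 * s)%:M.
  rewrite /v linearB /= mulmxBl !mulmxBr ee aa ea' ae -!raddfB /=.
  by congr (_ %:M); ring.
have ve : v *m e^T = (1 - s)%:M by rewrite /v mulmxBl ee ae -raddfB.
have s1 : 1 - s != 0.
  apply: contra ea => /eqP s1; rewrite -subr_eq0 -/v.
  have : dot v v = 0.
    have -> : dot v v = 2 * (1 - s) by rewrite /dot vv mxE eqxx mulr1n; ring.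
    by rewrite s1 mulr0.
  rewrite dotE => /eqP; rewrite psumr_eq0 => [/allP h|i _]; last first.
    by rewrite -expr2 sqr_ge0.
  apply/eqP/rowP => i; rewrite [RHS]mxE; apply/eqP.
  by have := h i (mem_index_enum i); rewrite /= mulf_eq0 orbb.
pose H : 'M[R]_n.+1 := 1%:M - (1 - s)^-1 *: (v^T *m v).
have HT : H^T = H by rewrite /H linearB /= linearZ /= trmx1 trmx_mul trmxK.
have He : H *m e^T = a^T.
  rewrite /H mulmxBl mul1mx -scalemxAl -mulmxA ve mul_mx_scalar scalerA.
  by rewrite mulVf// scale1r /v linearB opprB addrC subrK.
exists H; split => //; rewrite HT.
rewrite {1}/H mulmxBl mul1mx -scalemxAl -mulmxA.
have -> : v *m H = - v.
  rewrite /H mulmxBr mulmx1 -scalemxAr mulmxA vv mul_scalar_mx scalerA.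
  by rewrite (_ : _ * _ = 2); [rewrite scaler_nat mulr2n opprD addrA subrr add0r|field].
by rewrite mulmxN scalerN opprK /H subrK.
Qed.

Let measurable_mulmx (B : 'M[R]_(n, n.+1)) :
  measurable_fun setT (fun w : 'rV[R]_n => w *m B).
Proof.
apply: measurable_fun_rV => i.
rewrite (_ : _ \o _ = fun w => \sum_(j < n) (coord_rV j w * B j i : R)).
  apply: measurable_sum => j; apply: measurable_funM => //.
  exact: measurable_coord_rV.
by apply/funext => w; rewrite /coord_rV /= mxE.
Qed.

Definition lebesgue_perp (e : 'rV[R]_n.+1) : set 'rV[R]_n.+1 -> \bar R :=
  push (@measurable_mulmx (perp_frame e)) (lebesgue_rV n).

HB.instance Definition _ e := Measure.on (lebesgue_perp e).

End lebesgue_perp.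

(* Functions measurable for the completion of mu, i.e. Lebesgue-measurable
   functions when mu is a Lebesgue measure on the Borel sigma-algebra. *)
Definition completed_measurable_fun d (T : measurableType d) (R : realType)
    (mu : set T -> \bar R) (D : set T) (f : T -> R) : Prop :=
  forall Y : set (measurableTypeR R), measurable Y ->
    completed_algebra_gen mu (D `&` f @^-1` Y).

Section failure_energy.
Context {R : realType} {n : nat}.
Local Notation V := 'rV[R]_n.+1.

Definition bounded_domain (Omega : set V) : Prop :=
  [/\ Omega !=set0, open Omega, connected Omega & bounded_set Omega].

Definition influence_function (J : R -> R) (M : R) : Prop :=
  [/\ forall r, 0 <= r -> 0 <= J r,
      forall r s, 0 <= r -> r <= s -> J s <= J r,
      forall r, 0 <= r -> r < 1 -> 0 < J r,
      J 0 = M &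
      forall r, 1 <= r -> J r = 0].

(* gamma y x t is the degradation factor of the bond between x and y. *)
Definition degradation_factor (Omega : set V) (T : R) (gamma : V -> V -> R -> R)
    : Prop :=
  forall t, 0 <= t -> t <= T ->
  [/\ completed_measurable_fun (lebesgue_rV n.+1 \x lebesgue_rV n.+1)%E
        (Omega `*` Omega) (fun p => gamma p.1 p.2 t),
      forall x y, Omega x -> Omega y -> 0 <= gamma y x t <= 1 &
      forall x y, Omega x -> Omega y -> gamma y x t = gamma x y t].

Definition ball_volume (d : nat) : R := fine (lebesgue_rV d (eball 0 1)).

Definition kernel (Omega : set V) (J : R -> R) (eps : R) (y x : V) : R :=
  \1_Omega y * J (enorm (y - x) / eps)
    / (eps * (ball_volume n.+1 * eps ^+ n.+1)).

Definition failure_set (Omega : set V) (eps : R) (gamma : V -> V -> R -> R)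
    (t : R) : set (V * V) :=
  [set p | Omega p.1 /\ (Omega `&` eball p.1 eps) p.2 /\ gamma p.2 p.1 t = 0].

Definition failed (Omega : set V) (eps : R) (gamma : V -> V -> R -> R)
    (y x : V) (t : R) : R :=
  \1_(failure_set Omega eps gamma t) (x, y).

Definition failure_energy (Omega : set V) (J : R -> R) (eps Cp : R)
    (gamma : V -> V -> R -> R) (t : R) : \bar R :=
  (\int[lebesgue_rV n.+1]_(x in Omega) \int[lebesgue_rV n.+1]_(y in Omega)
     (kernel Omega J eps y x * Cp * failed Omega eps gamma y x t)%:E)%E.

Definition slice (Omega : set V) (e z : V) : set R :=
  [set s | Omega (z + s *: e)].

Definition shadow (Omega : set V) (e : V) : set V :=
  [set z | dot z e = 0 /\ slice Omega e z !=set0].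

Definition slice_multiplicity (Omega : set V) (eps : R)
    (gamma : V -> V -> R -> R) (t : R) (e z : V) (q : R) : \bar R :=
  (((eps * q)^-1)%:E * \int[lebesgue_measure]_(s in slice Omega e z)
     (failed Omega eps gamma (z + (s + eps * q) *: e) (z + s *: e) t)%:E)%E.

End failure_energy.

(* Main.v *)
(* Writing y = x + h and exchanging the integrals, the energy becomes the
   integral over h of J(|h|/eps) times the measure of the set of points x whose
   bond with x + h has failed.  Polar coordinates h = eps q e, and then Fubini
   along the direction e in the integral over x, give the right-hand side.

   The failure set lies between two Borel sets that differ by a null set.  Both
   sides of the formula are monotone in the failure set, the library's integral
   of a nonnegative nonmeasurable function being a lower integral, so that it
   suffices to treat Borel sets. *)

Require Import Defs.
From HB Require Import structures.
From mathcomp Require Import all_boot all_order all_algebra.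
From mathcomp Require Import all_classical all_reals all_analysis.
From mathcomp Require Import measurable_realfun ring.

Import Order.TTheory GRing.Theory Num.Theory.
Import numFieldNormedType.Exports.

Local Open Scope classical_set_scope.
Local Open Scope ring_scope.

(** * Lower integrals and transport of integrals *)

(** Two constructions hide their symmetry. [lebesgue_rV] is an iterated product that favours the
    coordinate axes, so Fubini along an arbitrary [e] needs invariance under orthogonal maps.
    [sphere_measure] is given by two graphs over the equatorial hyperplane, so polar coordinates are
    proved for each hemisphere and then glued.

    The null set between the two Borel sets is null for the measure on pairs, which says nothing
    about its trace on one given line. The slices are therefore never asked to ignore it: for both
    Borel sets the sliced integral equals the double integral, and only there is the null set
    discarded.

    For Borel sets the integrals run over the whole space, hyperplane and line. [Omega], its slices
    and its shadows return only in the final inequalities. *)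

Section integral_generalities.
Local Open Scope ereal_scope.

(* No measurability is assumed: the library's integral of a nonnegative
   function is then a lower integral, which is still monotone. *)
Lemma ge0_le_lower_integral d (T : measurableType d) (R : realType)
    (mu : {measure set T -> \bar R}) (f g : T -> \bar R) :
  (forall x, 0 <= f x) -> (forall x, f x <= g x) ->
  \int[mu]_x f x <= \int[mu]_x g x.
Proof.
move=> f0 fg.
have g0 x : 0 <= g x by exact: le_trans (fg x).
rewrite !ge0_integralTE//; apply: le_ereal_sup => _ [h /= hf <-].
by exists h => // x; exact: le_trans (fg x).
Qed.

(** Extension by zero reduces the claim to the whole space. [D] need not lie in [E] provided [f]
    vanishes on the difference: this is how integrals over whole spaces are bounded by integrals
    over [Omega], its slices and its shadows. *)
Lemma ge0_le_lower_integral_dom d (T : measurableType d) (R : realType)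
    (mu : {measure set T -> \bar R}) (D E : set T) (f g : T -> \bar R) :
  (forall x, D x -> 0 <= f x) -> (forall x, E x -> 0 <= g x) ->
  (forall x, D x -> E x -> f x <= g x) ->
  (forall x, D x -> ~ E x -> f x = 0) ->
  \int[mu]_(x in D) f x <= \int[mu]_(x in E) g x.
Proof.
move=> f0 g0 fg fE; rewrite integral_mkcond [leRHS]integral_mkcond.
apply: ge0_le_lower_integral => x; rewrite !patchE.
  by case: ifPn => // /[!inE]; exact: f0.
case: ifPn => [/[!inE] Dx|_]; case: ifPn => [/[!inE] Ex|/negP Ex] //.
- exact: fg.
- by rewrite fE// => /mem_set.
- exact: g0.
Qed.

Lemma ge0_le_lower_integral_subset d (T : measurableType d) (R : realType)
    (mu : {measure set T -> \bar R}) (D E : set T) (f g : T -> \bar R) :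
  D `<=` E ->
  (forall x, D x -> 0 <= f x) -> (forall x, E x -> 0 <= g x) ->
  (forall x, D x -> f x <= g x) ->
  \int[mu]_(x in D) f x <= \int[mu]_(x in E) g x.
Proof.
move=> DE f0 g0 fg; apply: ge0_le_lower_integral_dom => // x Dx.
  by move=> _; exact: fg.
by move=> /(_ (DE _ Dx)).
Qed.

Import HBNNSimple.

(** The hypothesis says that [nu] is the image under [phi] of the measure of density [b]. Testing it
    on indicators suffices, by simple functions and monotone convergence. It serves for
    substitutions on the line and, with [phi] the identity, for the area element of the sphere. *)
Lemma ge0_integral_transport d1 d2 (X : measurableType d1)
    (Y : measurableType d2) (R : realType)
    (mu : {measure set X -> \bar R}) (nu : {measure set Y -> \bar R})
    (b : X -> R) (phi : X -> Y) :
  measurable_fun setT b -> (forall x, 0 <= b x)%R -> measurable_fun setT phi ->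
  (forall A, measurable A ->
    nu A = \int[mu]_x ((b x)%:E * (\1_A (phi x))%:E)) ->
  forall f : Y -> \bar R, measurable_fun setT f -> (forall y, 0 <= f y) ->
  \int[nu]_y f y = \int[mu]_x ((b x)%:E * f (phi x)).
Proof.
move=> mb b0 mphi nuE f mf f0.
pose f_ := nnsfun_approx measurableT mf.
have cf_ y : (f_ n y)%:E @[n --> \oo] --> f y by exact: cvg_nnsfun_approx.
have ndf_ y : {homo (fun n => (f_ n y)%:E) : m n / (m <= n)%N >-> m <= n}.
  by move=> m n mn; rewrite lee_fin; exact/lefP/nd_nnsfun_approx.
transitivity (limn (fun n => \int[nu]_y (f_ n y)%:E)).
  rewrite -monotone_convergence//.
  - by apply: eq_integral => y _; apply/esym/cvg_lim.
  - by move=> n; exact/measurable_EFinP/measurable_funP.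
  - by move=> n y _; rewrite lee_fin.
transitivity (limn (fun n => \int[mu]_x ((b x)%:E * (f_ n (phi x))%:E))); last first.
  rewrite -monotone_convergence//.
  - apply: eq_integral => x _; apply/cvg_lim => //.
    by apply: cvgeZl.
  - move=> n; apply: emeasurable_funM; first exact/measurable_EFinP.
    apply/measurable_EFinP; apply: measurableT_comp => //.
  - by move=> n x _; rewrite -EFinM lee_fin mulr_ge0.
  - by move=> x _ m n mn; rewrite lee_wpmul2l ?lee_fin//; exact/lefP/nd_nnsfun_approx.
congr (limn _); apply/funext => n.
rewrite integralT_nnsfun sintegralE.
transitivity (\sum_(k \in range (f_ n))
    \int[mu]_x (k%:E * ((b x)%:E * (\1_(f_ n @^-1` [set k]) (phi x))%:E))).
  apply: eq_fsbigr => k; rewrite inE => -[y _ <-].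
  rewrite ge0_integralZl//.
  - by rewrite nuE.
  - apply: emeasurable_funM; first exact/measurable_EFinP.
    apply/measurable_EFinP; apply: measurableT_comp => //.
  - by move=> x _; rewrite -EFinM lee_fin mulr_ge0.
  - by rewrite lee_fin.
rewrite -ge0_integral_fsum//.
- apply: eq_integral => x _.
  rewrite fimfunE -fsumEFin// ge0_mule_fsumr//; last first.
    by move=> k; rewrite nnfun_muleindic_ge0.
  by apply: eq_fsbigr => k _; rewrite EFinM muleCA.
- move=> k; apply: emeasurable_funM => //.
  apply: emeasurable_funM; first exact/measurable_EFinP.
  by apply/measurable_EFinP; apply: measurableT_comp.
- move=> k x _; rewrite muleCA mule_ge0// ?lee_fin//.
  exact: nnfun_muleindic_ge0.
Qed.

End integral_generalities.

(** * Tonelli's theorem for curried integrands *)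

Section curried_tonelli.
Local Open Scope ereal_scope.
Context d1 d2 (X : measurableType d1) (Y : measurableType d2) (R : realType).
Variables (m1 : {sigma_finite_measure set X -> \bar R})
  (m2 : {sigma_finite_measure set Y -> \bar R}) (f : X -> Y -> \bar R).
Hypothesis mf : measurable_fun setT (fun p : X * Y => f p.1 p.2).
Hypothesis f0 : forall x y, 0 <= f x y.

Lemma measurable_fun_integral_l :
  measurable_fun setT (fun y => \int[m1]_x f x y).
Proof.
exact: (measurable_fun_fubini_tonelli_G (m1 := m1) _ mf (fun p => f0 p.1 p.2)).
Qed.

Lemma measurable_fun_integral_r :
  measurable_fun setT (fun x => \int[m2]_y f x y).
Proof.
exact: (measurable_fun_fubini_tonelli_F (m2 := m2) _ mf (fun p => f0 p.1 p.2)).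
Qed.

Lemma ge0_exchange_integral :
  \int[m1]_x \int[m2]_y f x y = \int[m2]_y \int[m1]_x f x y.
Proof.
exact: (fubini_tonelli (m1 := m1) (m2 := m2) _ mf (fun p => f0 p.1 p.2)).
Qed.

End curried_tonelli.

(** * Change of variables on the real line *)

Section lebesgue_transport.
Context {R : realType}.
Local Notation mu := (@lebesgue_measure R).
Local Open Scope ereal_scope.

(** The measure of density [b], pushed by [phi], gives each []p, q]] its length, hence is Lebesgue
    measure by uniqueness. Stated through preimages of intervals, the criterion accommodates a [phi]
    defined by pieces. *)
Lemma ge0_integral_lebesgue_transport (b phi : R -> R) :
  measurable_fun setT b -> (forall x, 0 <= b x)%R -> measurable_fun setT phi ->
  (forall p q, (p < q)%R ->
    \int[mu]_(x in phi @^-1` `]p, q]) (b x)%:E = (q - p)%:E) ->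
  forall f : R -> \bar R, measurable_fun setT f -> (forall y, 0 <= f y) ->
  \int[mu]_y f y = \int[mu]_x ((b x)%:E * f (phi x)).
Proof.
move=> mb b0 mphi nuE.
have mEb : measurable_fun setT (EFin \o b) by exact/measurable_EFinP.
pose m0 A := \int[mu]_(x in A) (b x)%:E.
have m00 : m0 set0 = 0 by rewrite /m0 integral_set0.
have m0_ge0 A : 0 <= m0 A by apply: integral_ge0 => x _; rewrite lee_fin.
have m0_sa : semi_sigma_additive m0.
  by apply: semi_sigma_additive_nng_induced => // x; rewrite lee_fin.
pose m : {measure set (measurableTypeR R) -> \bar R} :=
  HB.pack m0 (isMeasure.Build _ _ _ m0 m00 m0_ge0 m0_sa).
apply: (@ge0_integral_transport _ _ (measurableTypeR R) (measurableTypeR R)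
  _ mu mu b phi) => // A mA.
have mphi' : measurable_fun setT
  (phi : measurableTypeR R -> measurableTypeR R) by [].
transitivity (push mphi' m A); last first.
  rewrite /push /pushforward /= /m0 integral_mkcond.
  apply: eq_integral => x _; rewrite patchE indicE.
  have -> : (x \in phi @^-1` A) = (phi x \in A) by apply/idP/idP; rewrite !inE.
  by case: ifP; rewrite ?mule1 ?mule0.
apply: (@lebesgue_measure_unique _ (push mphi' m)) => // _ [[p q] _ <-] /=.
rewrite /push /pushforward /= /m0.
have [pq|qp] := ltP p q.
  by rewrite nuE// lebesgue_measure_itv/= lte_fin pq EFinB.
by rewrite set_itv_ge ?preimage_set0 ?integral_set0 ?measure0// bnd_simp -leNgt.
Qed.

Lemma ge0_integral_lebesgue_affine (r a : R) (f : R -> \bar R) :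
  (0 < r)%R -> measurable_fun setT f -> (forall y, 0 <= f y) ->
  \int[mu]_y f y = \int[mu]_x (r%:E * f (r * x + a)%R).
Proof.
move=> r0 mf f0.
apply: (@ge0_integral_lebesgue_transport (cst r) (fun x => r * x + a)%R) => //.
- by move=> ?; exact: ltW.
- by apply: measurable_funD => //; exact: measurable_funM.
move=> p q pq; have -> : (fun x => (cst r x)%:E) = cst r%:E by [].
rewrite integral_cst/=; last first.
  rewrite -[X in measurable X]setTI.
  suff : measurable_fun setT (fun x : R => r * x + a)%R by apply.
  by apply: measurable_funD => //; exact: measurable_funM.
rewrite (_ : _ @^-1` _ = `]((p - a) / r)%R, ((q - a) / r)%R]%classic).
  rewrite lebesgue_measure_itv/= lte_fin ltr_pM2r ?invr_gt0// ltrD2r pq.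
  by rewrite -EFinB -EFinM; congr EFin; field; rewrite gt_eqF.
apply/seteqP; split => x /=; rewrite !in_itv/= ltr_pdivrMr// ler_pdivlMr//;
  by rewrite ltrBlDr lerBrDr mulrC.
Qed.

End lebesgue_transport.

(** * The substitution y = sqrt (x^2 + c) on a half-line *)

Section hyperbola_substitution.
Context {R : realType}.
Variable c : R.
Hypothesis c0 : 0 < c.
Local Notation mu := (@lebesgue_measure R).

Let T (x : R) : R := Num.sqrt (x ^+ 2 + c).

Let T2_gt0 x : 0 < x ^+ 2 + c.
Proof. by rewrite ltr_wpDl// sqr_ge0. Qed.

Let T_gt0 x : 0 < T x. Proof. by rewrite sqrtr_gt0. Qed.

Let is_derive_T (x : R) : is_derive x (1 : R) (T : R -> R) (x / T x).
Proof.
have h : is_derive (x : R) (1 : R) (fun x : R => x ^+ 2 + c : R) (2 * x).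
  apply: is_derive_eq; rewrite addr0 /GRing.scale /=; ring.
have := @is_derive1_comp _ Num.sqrt (fun x : R => x ^+ 2 + c) x _ _
  (is_derive1_sqrt (T2_gt0 x)) h.
rewrite (_ : (2 * _)^-1 * _ = x / T x)//.
by rewrite /T; field; rewrite gt_eqF// T_gt0.
Qed.

Let continuous_T : continuous T.
Proof.
by move=> x; apply/differentiable_continuous/derivable1_diffP; case: (is_derive_T x).
Qed.

Let continuous_dT : continuous (fun x : R => x / T x : R).
Proof.
move=> x; apply: cvgM; first exact: cvg_id.
apply: cvgV; last exact: continuous_T.
by rewrite gt_eqF.
Qed.

Let T_lt (x y : R) : 0 <= x -> x < y -> T x < T y.
Proof.
by move=> x0 xy; rewrite ltr_sqrt// ltrD2r ltr_pXn2r// nnegrE// (le_trans x0)// ltW.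
Qed.

Let measurable_dT : measurable_fun setT (fun x : R => x / T x).
Proof. by apply: continuous_measurable_fun; exact: continuous_dT. Qed.

Let integral_dT a b : a < b ->
  (\int[mu]_(x in `]a, b]) (x / T x)%:E = (T b - T a)%:E)%E.
Proof.
move=> ab; rewrite integral_itv_obnd_cbnd; last first.
  by apply/measurable_EFinP; exact: measurable_funTS.
rewrite EFinB; apply: (@continuous_FTC2 _ (fun x => x / T x) T) => //.
- exact/continuous_subspaceT/continuous_dT.
- split.
  + by move=> x _; case: (is_derive_T x).
  + by apply/cvg_at_right_filter/continuous_T.
  + by apply/cvg_at_left_filter/continuous_T.
- by move=> x _; rewrite derive1E; case: (is_derive_T x).
Qed.

(** [T] only maps []0, +oo[] onto []sqrt c, +oo[]. The translation branch completes it into an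
    increasing bijection of the whole line, as the transport lemma works there; [b] is the
    derivative of [phi] away from 0. *)
Let phi (x : R) : R := if 0 < x then T x else x + Num.sqrt c.
Let b (x : R) : R := if 0 < x then x / T x else 1.

Let measurable_gt0 : measurable_fun setT (fun x : R => 0 < x).
Proof. exact: measurable_fun_ltr. Qed.

Let measurable_phi : measurable_fun setT phi.
Proof.
apply: measurable_fun_ifT => //; last exact: measurable_funD.
by apply: continuous_measurable_fun; exact: continuous_T.
Qed.

Let measurable_b : measurable_fun setT b.
Proof.
exact: measurable_fun_ifT.
Qed.

Let b_ge0 (x : R) : 0 <= b x.
Proof. by rewrite /b; case: ifPn => // x0; rewrite divr_ge0// ltW. Qed.

Let phi0 : phi 0 = T 0.
Proof. by rewrite /phi ltxx /T expr0n /= !add0r. Qed.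

Let integral_b (p q : R) : p < q ->
  (\int[mu]_(x in `]p, q]) (b x)%:E = (phi q - phi p)%:E)%E.
Proof.
(* [b] drops from 1 to 0 at the origin, so an interval is cut there. Being open on the left, []0,
   v]] leaves 0 to the other piece, and [b] is [x / T x] on all of it. *)
have pos u v : 0 <= u -> u < v ->
    (\int[mu]_(x in `]u, v]) (b x)%:E = (phi v - phi u)%:E)%E.
  move=> u0 uv.
  have phiT x : 0 <= x -> phi x = T x.
    rewrite le_eqVlt => /predU1P[<-|x0]; first exact: phi0.
    by rewrite /phi x0.
  rewrite !phiT// ?(le_trans u0) ?(ltW uv)// -integral_dT//.
  apply: eq_integral => x; rewrite inE/= in_itv/= => /andP[ux _].
  by rewrite /b (le_lt_trans u0 ux).
have neg u v : v <= 0 -> u < v ->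
    (\int[mu]_(x in `]u, v]) (b x)%:E = (phi v - phi u)%:E)%E.
  move=> v0 uv.
  have phiE x : x <= 0 -> phi x = x + Num.sqrt c.
    by move=> x0; rewrite /phi ltNge x0.
  rewrite !phiE// ?(le_trans (ltW uv))//.
  rewrite (eq_integral (cst 1%E)); last first.
    move=> x; rewrite inE/= in_itv/= => /andP[_ xv].
    by rewrite /b ltNge (le_trans xv).
  rewrite integral_cst//= mul1e lebesgue_measure_itv/= lte_fin uv -EFinB.
  by congr EFin; ring.
move=> pq; have [p0|p0] := leP 0 p; first exact: pos.
have [q0|q0] := leP q 0; first exact: neg.
rewrite (@itv_bndbnd_setU _ _ _ (BRight 0)) ?bnd_simp ?ltW//.
rewrite ge0_integral_setU//=.
- by rewrite (pos 0 q)// (neg p 0)// -EFinD; congr EFin; ring.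
- by apply/measurable_EFinP/measurable_funTS; exact: measurable_b.
- by move=> x _; rewrite lee_fin.
- apply/disj_setPS => x /=; rewrite !in_itv/= => -[/andP[_ x0] /andP[]].
  by rewrite ltNge x0.
Qed.

(** The inverse of [phi], by which the preimage of []p, q]] is []g p, g q]]. *)
Let g (y : R) : R := if Num.sqrt c < y then Num.sqrt (y ^+ 2 - c) else y - Num.sqrt c.

Let phi_lt : {homo phi : x y / x < y}.
Proof.
move=> x y xy.
rewrite /phi; case: ifPn => [x0|]; first by rewrite (lt_trans x0 xy) T_lt// ltW.
rewrite -leNgt => x0; case: ifPn => [y0|]; last by rewrite ltrD2r.
rewrite (@le_lt_trans _ _ (T 0))// ?T_lt// /T expr0n/= add0r gerDr//.
Qed.

Let gK y : phi (g y) = y.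
Proof.
rewrite /g; case: ltP => cy; rewrite /phi.
  have y0 : 0 < y by rewrite (le_lt_trans _ cy)// sqrtr_ge0.
  have cy2 : 0 < y ^+ 2 - c.
    rewrite subr_gt0 -[ltLHS]sqr_sqrtr ?ltW// ltr_pXn2r// nnegrE ?sqrtr_ge0//.
    exact: ltW.
  by rewrite sqrtr_gt0 cy2 /T sqr_sqrtr ?(ltW cy2)// subrK sqrtr_sqr gtr0_norm.
by rewrite subr_gt0 ltNge cy subrK.
Qed.

(** [phi x] exceeds [sqrt c] exactly when [x] is positive, so restricting [f] to []sqrt c, +oo[]
    discards the auxiliary translation branch. *)
Lemma ge0_integral_sqrt_substitution (f : R -> \bar R) :
  measurable_fun setT f -> (forall x, (0 <= f x)%E) ->
  (\int[mu]_(r in `]Num.sqrt c, +oo[) f r =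
   \int[mu]_(x in `]0%R, +oo[)
     ((x / Num.sqrt (x ^+ 2 + c))%:E * f (Num.sqrt (x ^+ 2 + c))))%E.
Proof.
move=> mf f0.
rewrite integral_mkcond.
rewrite (@ge0_integral_lebesgue_transport _ b phi)//; first last.
- by move=> y; rewrite patchE; case: ifPn.
- apply/(measurable_restrictT _ _).1 => //; exact: measurable_funTS.
- move=> p q pq; rewrite (_ : _ @^-1` _ = `]g p, g q]%classic).
    rewrite integral_b ?gK//.
    by rewrite ltNge; apply/negP => /(ltW_homo phi_lt); rewrite !gK leNgt pq.
  have m := leW_mono (le_mono phi_lt); have m' := le_mono phi_lt.
  by apply/seteqP; split => x /=; rewrite !in_itv/= -(m (g p)) -(m' _ (g q)) !gK.
rewrite [RHS]integral_mkcond; apply: eq_integral => x _.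
rewrite !patchE !mem_setE !in_itv/= !andbT /b /phi.
case: ifPn => x0.
  rewrite -/(T x) ifT//.
  by rewrite (le_lt_trans _ (T_lt _ _ (lexx 0) x0))// /T expr0n/= add0r.
by rewrite mul1e ifF// -subr_gt0 addrK (negbTE x0).
Qed.

End hyperbola_substitution.

(** * Lebesgue measure on row vectors *)

Section measurability_rV.
Context {R : realType} d (T : measurableType d) (n : nat).
Implicit Types (k : T -> R) (f g : T -> 'rV[R]_n).

Lemma measurable_fun_coord f (i : 'I_n) :
  measurable_fun setT f -> measurable_fun setT (fun x => f x 0 i).
Proof.
by move=> mf; apply: (measurableT_comp (@measurable_coord_rV R n i)).
Qed.

Lemma measurable_fun_addrV f g : measurable_fun setT f ->
  measurable_fun setT g -> measurable_fun setT (fun x => f x + g x).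
Proof.
move=> mf mg; apply: measurable_fun_rV => i.
rewrite (_ : _ \o _ = fun x => f x 0 i + g x 0 i).
  by apply: measurable_funD; exact: measurable_fun_coord.
by apply/funext => x; rewrite /coord_rV /= mxE.
Qed.

Lemma measurable_fun_scalerV k f : measurable_fun setT k ->
  measurable_fun setT f -> measurable_fun setT (fun x => k x *: f x).
Proof.
move=> mk mf; apply: measurable_fun_rV => i.
rewrite (_ : _ \o _ = fun x => k x * f x 0 i).
  by apply: measurable_funM => //; exact: measurable_fun_coord.
by apply/funext => x; rewrite /coord_rV /= mxE.
Qed.

Lemma measurable_fun_mulmxrV m f (B : 'M[R]_(n, m)) : measurable_fun setT f ->
  measurable_fun setT (fun x => f x *m B).
Proof.
move=> mf; apply: measurable_fun_rV => i.
rewrite (_ : _ \o _ = fun x => \sum_(j < n) (f x 0 j * B j i)).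
  apply: measurable_sum => j; apply: measurable_funM => //.
  exact: measurable_fun_coord.
by apply/funext => x; rewrite /coord_rV /= mxE.
Qed.

Lemma measurable_fun_dot f g : measurable_fun setT f ->
  measurable_fun setT g -> measurable_fun setT (fun x => dot (f x) (g x)).
Proof.
move=> mf mg.
rewrite (_ : (fun x => _) = fun x => \sum_(j < n) (f x 0 j * g x 0 j)).
  by apply: measurable_sum => j; apply: measurable_funM => //;
    exact: measurable_fun_coord.
by apply/funext => x; rewrite dotE.
Qed.

Lemma measurable_fun_sqrt k : measurable_fun setT k ->
  measurable_fun setT (fun x => Num.sqrt (k x)).
Proof.
have ms : measurable_fun setT (@Num.sqrt R).
  by apply: continuous_measurable_fun; exact: sqrt_continuous.
by move=> mk; exact: (measurableT_comp ms).
Qed.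

(** The power with exponent -1 is the inverse on nonnegative reals, whence the split on the sign. *)
Lemma measurable_fun_inv k : measurable_fun setT k ->
  measurable_fun setT (fun x => (k x)^-1).
Proof.
move=> mk; rewrite (_ : (fun x => _) = (fun x => if 0 <= k x then k x `^ (-1)
  else - ((- k x) `^ (-1)))).
  apply: measurable_fun_ifT.
  - exact: measurable_fun_ler.
  - by apply: (measurableT_comp (measurable_powR _)).
  - apply/measurable_funN; apply: (measurableT_comp (measurable_powR _)).
    exact/measurable_funN.
apply/funext => x; case: ifPn => [k0|]; first by rewrite powR_inv1.
by rewrite -ltNge => k0; rewrite powR_inv1 ?oppr_ge0 ?(ltW k0)// invrN opprK.
Qed.

Lemma measurable_fun_cons_rV k f : measurable_fun setT k ->
  measurable_fun setT f -> measurable_fun setT (fun x => cons_rV (k x, f x)).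
Proof.
move=> mk mf; apply: (measurableT_comp (@measurable_cons_rV R n)).
by apply: measurable_fun_pair.
Qed.

Lemma measurable_fun_enorm f : measurable_fun setT f ->
  measurable_fun setT (fun x => enorm (f x)).
Proof. by move=> mf; apply: measurable_fun_sqrt; exact: measurable_fun_dot. Qed.

End measurability_rV.

(** * Integration over row vectors, one coordinate at a time *)

Section lebesgue_rV_integral.
Context {R : realType}.
Local Notation mu := (@lebesgue_measure R).
Local Open Scope ereal_scope.

Lemma ge0_integral_rVS n (f : 'rV[R]_n.+1 -> \bar R) :
  measurable_fun setT f -> (forall v, 0 <= f v) ->
  \int[lebesgue_rV n.+1]_v f v =
  \int[lebesgue_rV n]_v \int[mu]_x f (cons_rV (x, v)).
Proof.
move=> mf f0.
have mfc : measurable_fun setT (f \o @cons_rV R n).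
  exact: measurableT_comp (@measurable_cons_rV R n).
transitivity (\int[(mu \x^ lebesgue_rV n)%E]_p f (cons_rV p)).
  rewrite /lebesgue_rV /= /push ge0_integral_pushforward//.
  exact: measurable_cons_rV.
(* Both product measures have the same values on rectangles, hence coincide; Tonelli is applied to
   [\x]. *)
transitivity (\int[(mu \x lebesgue_rV n)%E]_p f (cons_rV p)).
  apply/esym/eq_measure_integral => A mA _; apply: product_measure_unique => //.
  by move=> B C mB mC; rewrite /= product_measure2E.
by rewrite (fubini_tonelli2 (f \o @cons_rV R n))//= => p; exact: f0.
Qed.

Lemma cons_rV_eta n (v : 'rV[R]_n.+1) :
  v = cons_rV (v 0%R ord0, \row_(j < n) v 0%R (lift ord0 j)).
Proof.
apply/rowP => i; case: (unliftP ord0 i) => [j ->|->].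
  by rewrite cons_rVS mxE.
by rewrite cons_rV0.
Qed.

(** Induction on the dimension, each coordinate contributing one factor [r]. The case [r = 1] gives
    translations and the case [a = 0] dilations. *)
Lemma ge0_integral_rV_affine n (r : R) (a : 'rV[R]_n) (f : 'rV[R]_n -> \bar R) :
  (0 < r)%R -> measurable_fun setT f -> (forall v, 0 <= f v) ->
  \int[lebesgue_rV n]_v f v =
  \int[lebesgue_rV n]_v ((r ^+ n)%:E * f (r *: v + a)%R).
Proof.
move=> r0; elim: n a f => [|n IH] a f mf f0.
  have -> : (fun v : 'rV[R]_0 => (r ^+ 0)%:E * f (r *: v + a)%R) = f.
    by apply/funext => v; rewrite mul1e; congr f; apply/rowP => -[].
  by [].
have mrv : measurable_fun setT (fun v : 'rV[R]_n.+1 => r *: v + a)%R.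
  apply: measurable_fun_addrV => //; exact: measurable_fun_scalerV.
have mfrv : measurable_fun setT (fun v : 'rV[R]_n.+1 => f (r *: v + a)%R).
  exact: (measurableT_comp mf).
pose a' : 'rV[R]_n := (\row_(j < n) a 0 (lift ord0 j))%R.
have mfc : measurable_fun setT (f \o @cons_rV R n).
  exact: measurableT_comp (@measurable_cons_rV R n).
rewrite !ge0_integral_rVS//; last 2 first.
- exact: measurable_funeM.
- by move=> v; rewrite mule_ge0// lee_fin exprn_ge0// ltW.
rewrite (IH a'); last 2 first.
- apply: (measurable_fun_integral_l _ _ _ _ _ _ (fun x v => f (cons_rV (x, v)))) => //.
- by move=> v; apply: integral_ge0.
apply: eq_integral => v _.
rewrite (@ge0_integral_lebesgue_affine _ r (a 0%R ord0))//; last first.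
  apply: (measurableT_comp mf); apply: (measurable_fun_cons_rV) => //.
rewrite -ge0_integralZl//.
- apply: eq_integral => x _; rewrite muleA -EFinM -exprSr; congr (_ * f _).
  rewrite [RHS]cons_rV_eta; congr cons_rV; congr pair.
    by rewrite 2!mxE cons_rV0.
  by apply/rowP => j; rewrite [RHS]mxE 2![in RHS]mxE cons_rVS !mxE.
- apply: measurable_funeM; apply: (measurableT_comp mf).
  by apply: measurable_fun_cons_rV => //; apply: measurable_funD => //;
    exact: measurable_funM.
- by move=> x _; rewrite mule_ge0// lee_fin ltW.
- by rewrite lee_fin exprn_ge0// ltW.
Qed.

End lebesgue_rV_integral.

(** * Invariance of Lebesgue measure under translations and orthogonal maps *)

Section rotation_invariance.
Context {R : realType}.
Local Notation mu := (@lebesgue_measure R).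
Local Open Scope ereal_scope.

Lemma ge0_integral_rV_translation n (a : 'rV[R]_n) (f : 'rV[R]_n -> \bar R) :
  measurable_fun setT f -> (forall v, 0 <= f v) ->
  \int[lebesgue_rV n]_v f v = \int[lebesgue_rV n]_v f (v + a)%R.
Proof.
move=> mf f0; rewrite (@ge0_integral_rV_affine _ _ 1%R a)//.
by apply: eq_integral => v _; rewrite expr1n mul1e scale1r.
Qed.

Definition box n (r : R) : set 'rV[R]_n :=
  [set v | forall i, (`|v 0%R i| <= r)%R].

Lemma measurable_box n r : measurable (@box n r).
Proof.
rewrite (_ : @box n r = \bigcap_(i in [set: 'I_n])
    (@coord_rV R n i @^-1` `[(- r)%R, r])).
  apply: fin_bigcap_measurable => // i _.
  by rewrite -[X in measurable X]setTI; exact: measurable_coord_rV.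
apply/seteqP; split => v /= h i.
  by move=> _; rewrite /= in_itv /= -ler_norml; exact: h.
by have := h i I; rewrite /= in_itv /= -ler_norml.
Qed.

Lemma lebesgue_box n r : (0 < r)%R ->
  lebesgue_rV n (@box n r) = ((2 * r) ^+ n)%:E.
Proof.
move=> r0; elim: n => [|n ih].
  rewrite /lebesgue_rV /= diracE expr0.
  by rewrite mem_set// => -[].
have -> : lebesgue_rV n.+1 (@box n.+1 r) =
    (mu \x^ lebesgue_rV n) (`[(- r)%R, r]%classic `*` @box n r).
  rewrite /lebesgue_rV /= /push /pushforward; congr (_ _).
  apply/seteqP; split => -[x v] /=; rewrite in_itv /= -ler_norml => h.
    split; first by have := h ord0; rewrite cons_rV0.
    by move=> i; have := h (lift ord0 i); rewrite cons_rVS.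
  case: h => h1 h2 i; case: (unliftP ord0 i) => [j ->|->].
    by rewrite cons_rVS; exact: h2.
  by rewrite cons_rV0.
rewrite product_measure2E//=; last exact: measurable_box.
rewrite [X in _ * X]ih lebesgue_measure_itv/= lte_fin gtrN// -EFinB -EFinM.
by rewrite exprS; congr (_ * _)%:E; ring.
Qed.

Lemma sqr_coord_le_dot n (v : 'rV[R]_n) i : (v 0%R i ^+ 2 <= dot v v)%R.
Proof.
rewrite dotE (bigD1 i)//= -expr2 lerDl sumr_ge0// => j _.
by rewrite -expr2 sqr_ge0.
Qed.

Lemma measurable_eball n (x : 'rV[R]_n) r : measurable (eball x r).
Proof.
have m : measurable_fun setT (fun y : 'rV[R]_n => enorm (y - x)).
  by apply: measurable_fun_enorm; exact: measurable_fun_addrV.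
rewrite -[X in measurable X]setTI (_ : eball x r =
    (fun y => enorm (y - x)) @^-1` `]-oo, r[%classic).
  exact: m.
by apply/seteqP; split => y; rewrite /= in_itv.
Qed.

Lemma lebesgue_unit_ball_gt0 n :
  0 < lebesgue_rV n (eball (0 : 'rV[R]_n) 1)%R.
Proof.
(* A box inside the ball: [|v_i| <= c <= 1] gives [v_i^2 <= c], and the sum of [n] such squares is
   at most [n / (n + 1)]. Taking [n + 1] makes the bound strict and covers [n = 0]. *)
pose c : R := (n.+1%:R)^-1%R.
have c0 : (0 < c)%R by rewrite invr_gt0 ltr0n.
apply: (@lt_le_trans _ _ (lebesgue_rV n (@box n c))).
  by rewrite lebesgue_box// lte_fin exprn_gt0// mulr_gt0.
apply: le_measure; rewrite ?inE; [exact: measurable_box|exact: measurable_eball|].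
move=> v vc; rewrite /eball /= subr0 /enorm -sqrtr1 ltr_sqrt// dotE.
apply: (@le_lt_trans _ _ (\sum_(i < n) c)%R); last first.
  by rewrite sumr_const card_ord -mulr_natl ltr_pdivrMr ?ltr0n// mul1r ltr_nat.
apply: ler_sum => i _.
have c1 : (c <= 1)%R by rewrite invf_le1 ?ltr0n// ler1n.
rewrite -expr2 -real_normK ?num_real// (le_trans _ (ler_piMl (ltW c0) c1))//.
by rewrite -expr2 lerXn2r// ?nnegrE ?(ltW c0).
Qed.

Lemma lebesgue_unit_ball_lty n :
  lebesgue_rV n (eball (0 : 'rV[R]_n) 1)%R < +oo.
Proof.
apply: (@le_lt_trans _ _ (lebesgue_rV n (@box n 1%R))).
  apply: le_measure; rewrite ?inE; [exact: measurable_eball|exact: measurable_box|].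
  move=> v; rewrite /eball /= subr0 => v1 i.
  rewrite -sqrtr_sqr (le_trans _ (ltW v1))// ler_wsqrtr//.
  exact: sqr_coord_le_dot.
by rewrite lebesgue_box// ltry.
Qed.

Lemma enorm_orthogonal n (U : 'M[R]_n) (v : 'rV[R]_n) :
  U *m U^T = 1%:M -> enorm (v *m U) = enorm v.
Proof.
by move=> UU; rewrite /enorm /dot trmx_mul mulmxA -(mulmxA v) UU mulmx1.
Qed.

Lemma enormN n (v : 'rV[R]_n) : enorm (- v)%R = enorm v.
Proof. by rewrite /enorm /dot linearN/= mulmxN mulNmx opprK. Qed.

(* The usual proof that Haar measure is unique, applied to Lebesgue measure and
   its image by U: both give the same mass to the unit ball. *)
Lemma ge0_integral_rV_orthogonal n (U : 'M[R]_n) (f : 'rV[R]_n -> \bar R) :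
  U *m U^T = 1%:M -> measurable_fun setT f -> (forall v, 0 <= f v) ->
  \int[lebesgue_rV n]_v f v = \int[lebesgue_rV n]_v f (v *m U).
Proof.
move=> UU mf f0.
have UTU : U^T *m U = 1%:M by exact: mulmx1C.
pose B : set 'rV[R]_n := eball 0%R 1%R.
have mB : measurable B by exact: measurable_eball.
pose e v : \bar R := (\1_B v)%:E.
have e0 v : 0 <= e v by rewrite lee_fin.
have me : measurable_fun setT e by apply/measurable_EFinP; exact: measurable_indic.
have intE : \int[lebesgue_rV n]_v e v = lebesgue_rV n B.
  by rewrite integral_indic// setIT.
have mfU : measurable_fun setT (fun v => f (v *m U)).
  by apply: (measurableT_comp mf); exact: measurable_fun_mulmxrV.
have B_fin : lebesgue_rV n B \is a fin_num.
  by rewrite ge0_fin_numE ?measure_ge0// lebesgue_unit_ball_lty.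
suff h : lebesgue_rV n B * \int[lebesgue_rV n]_v f (v *m U) =
    lebesgue_rV n B * \int[lebesgue_rV n]_v f v.
  have mono := lee_pmul2l B_fin (lebesgue_unit_ball_gt0 n).
  by apply/le_anti/andP; split; rewrite -mono h.
rewrite -{1}intE -ge0_integralZr//; last by apply: integral_ge0.
(* This double integral is computed in both orders. Integrating in [y] first, translation by
   [x *m U^T] removes the dependence on [x] and leaves the integral of [f (v *m U)]. *)
transitivity (\int[lebesgue_rV n]_x \int[lebesgue_rV n]_y
    (e x * f (y *m U + x)%R)).
  apply: eq_integral => x _.
  rewrite (@ge0_integral_rV_translation _ (x *m U^T)%R)// -ge0_integralZl//.
  - by apply: eq_integral => y _; rewrite mulmxDl -mulmxA UTU mulmx1.
  - by apply: (measurableT_comp mfU); exact: measurable_fun_addrV.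
(* In the other order, translating [x] by [- (y *m U)] moves the dependence on [y] from [f] to the
   ball. As the ball is invariant under [U] and under the sign change, [x - y *m U] and
   [y - x *m U^T] belong to it together. *)
have step2 y : \int[lebesgue_rV n]_x (e x * f (y *m U + x)%R) =
    \int[lebesgue_rV n]_x (e (y - x *m U^T)%R * f x).
  rewrite (@ge0_integral_rV_translation _ (- (y *m U))%R
    (fun x => e x * f (y *m U + x)%R)); last 2 first.
  - apply: emeasurable_funM; first exact: me.
    have := measurableT_comp mf (measurable_fun_addrV _ _ _ _ _
      (measurable_cst (y *m U)) (@measurable_id _ _ setT)).
    exact.
  - by move=> x; rewrite mule_ge0.
  apply: eq_integral => x _; rewrite addrCA subrr addr0; congr (_ * _).
  congr EFin; rewrite /e !indicE; congr (nat_of_bool _)%:R.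
  rewrite -[in RHS](mulmx1 y) -UU mulmxA -mulmxBl.
  rewrite /B /eball; apply/idP/idP; rewrite !inE/= !subr0.
    by rewrite -enormN opprB enorm_orthogonal// trmxK.
  by rewrite -enormN -mulNmx opprB enorm_orthogonal// trmxK.
have step3 x : \int[lebesgue_rV n]_y (e (y - x *m U^T)%R * f x) =
    lebesgue_rV n B * f x.
  have mex : measurable_fun setT (fun y : 'rV[R]_n => e (y - x *m U^T)%R).
    apply: (measurableT_comp me).
    exact: (measurable_fun_addrV _ _ _ _ _ (@measurable_id _ _ setT)).
  rewrite (ge0_integralZr _ measurableT mex (fun y _ => e0 _) (f0 x)).
  by rewrite -intE [in RHS](@ge0_integral_rV_translation _ (- (x *m U^T))%R e).
have m1 : measurable_fun setT
    (fun p : 'rV[R]_n * 'rV[R]_n => e p.1 * f (p.2 *m U + p.1)%R).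
  apply: emeasurable_funM; first exact: (measurableT_comp me).
  apply: (measurableT_comp mf); apply: measurable_fun_addrV => //.
  exact: measurable_fun_mulmxrV.
have m2 : measurable_fun setT
    (fun p : 'rV[R]_n * 'rV[R]_n => e (p.2 - p.1 *m U^T)%R * f p.1).
  apply: emeasurable_funM; last exact: (measurableT_comp mf).
  apply: (measurableT_comp me); apply: measurable_fun_addrV => //.
  rewrite (_ : (fun x => _) = fun p : 'rV[R]_n * 'rV[R]_n => p.1 *m - U^T)%R.
    exact: measurable_fun_mulmxrV.
  by apply/funext => p; rewrite mulmxN.
rewrite (ge0_exchange_integral _ _ _ _ _ _ _
  (fun x y => e x * f (y *m U + x)%R))//; last first.
  by move=> x y; rewrite mule_ge0.
under eq_integral do rewrite step2.
rewrite -(ge0_exchange_integral _ _ _ _ _ _ _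
  (fun x y : 'rV[R]_n => e (y - x *m U^T)%R * f x))//; last first.
  by move=> x y; rewrite mule_ge0.
under eq_integral do rewrite step3.
by rewrite ge0_integralZl// intE.
Qed.

End rotation_invariance.

(** * Slices along a direction *)

Section slicing.
Context {R : realType} {n : nat}.
Local Notation mu := (@lebesgue_measure R).
Local Notation V := 'rV[R]_n.+1.
Local Open Scope ereal_scope.

Definition perp (e : V) : set V := [set z | dot z e = 0%R].

Lemma measurable_perp e : measurable (perp e).
Proof.
have m : measurable_fun setT (fun z : V => dot z e) by exact: measurable_fun_dot.
by have := m measurableT [set 0%R] (measurable_set1 _); rewrite setTI.
Qed.

Lemma perp_frameP (e : V) : esphere e -> perp_basis e (perp_frame e).
Proof. by move=> /perp_basis_exists; exact: xgetPex. Qed.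

Lemma perp_basis_orthogonal (e : V) (B : 'M[R]_(n, n.+1)) :
  esphere e -> perp_basis e B ->
  (col_mx e B : 'M[R]_n.+1) *m (col_mx e B : 'M[R]_n.+1)^T = 1%:M.
Proof.
move=> e1 [BB Be].
have ee : e *m e^T = 1%:M.
  apply/matrixP => i j; rewrite !ord1 [RHS]mxE eqxx -/(dot e e).
  move: e1; rewrite /esphere /enorm /= => e1.
  rewrite -[LHS]sqr_sqrtr ?e1 ?expr1n// dotE sumr_ge0// => k _.
  by rewrite -expr2 sqr_ge0.
have eB : e *m B^T = 0%R by rewrite -[LHS]trmxK trmx_mul trmxK Be trmx0.
rewrite [in X in _ *m X](@tr_col_mx _ 1 n).
rewrite (@mul_col_row _ 1 n n.+1 1 n e B e^T B^T) ee eB Be BB.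
by rewrite -(@scalar_mx_block _ 1 n).
Qed.

Lemma cons_rV_mul (p : R * 'rV[R]_n) (e : V) (B : 'M[R]_(n, n.+1)) :
  cons_rV p *m (col_mx e B : 'M[R]_n.+1) = (p.2 *m B + p.1 *: e)%R.
Proof.
rewrite /cons_rV (@mul_row_col _ _ 1 n) addrC; congr (_ + _)%R.
apply/rowP => i; rewrite mxE big_ord1 !mxE.
by congr (_ * _)%R; rewrite ord1.
Qed.

Lemma ge0_integral_lebesgue_perp (e : V) (G : V -> \bar R) :
  esphere e -> measurable_fun setT G -> (forall z, 0 <= G z) ->
  \int[lebesgue_perp e]_(z in perp e) G z =
  \int[lebesgue_rV n]_w G (w *m perp_frame e).
Proof.
move=> e1 mG G0.
rewrite ge0_integral_pushforward//.
- rewrite (_ : _ @^-1` _ = setT)//; apply/seteqP; split => // w _.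
  by rewrite /perp /dot /= -mulmxA (perp_frameP e e1).2 mulmx0 mxE.
- exact: measurable_fun_mulmxrV.
- exact: measurable_perp.
- exact: measurable_funTS.
Qed.

(** The matrix with rows [e] and its frame [B] is orthogonal and sends [(s, w)] to
    [w *m B + s *: e]. Rotation invariance thus turns the direction [e] into the first coordinate
    axis, where Tonelli applies. *)
Lemma ge0_integral_slices (e : V) (F : V -> \bar R) :
  esphere e -> measurable_fun setT F -> (forall z, 0 <= F z) ->
  \int[lebesgue_perp e]_(z in perp e) \int[mu]_s F (z + s *: e)%R =
  \int[lebesgue_rV n.+1]_x F x.
Proof.
move=> e1 mF F0.
pose B := perp_frame e.
pose U : 'M[R]_n.+1 := col_mx e B.
have UU : U *m U^T = 1%:M by apply: perp_basis_orthogonal => //; exact: perp_frameP.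
rewrite ge0_integral_lebesgue_perp//; last 2 first.
- apply: (measurable_fun_integral_r _ _ _ _ _ lebesgue_measure
    (fun (z : V) (s : measurableTypeR R) => F (z + s *: e)%R)) => //.
  apply: (measurableT_comp mF); apply: measurable_fun_addrV => //.
  exact: measurable_fun_scalerV.
- by move=> z; exact: integral_ge0.
rewrite (ge0_integral_rV_orthogonal _ U)// ge0_integral_rVS//.
- by apply: eq_integral => w _; apply: eq_integral => s _; rewrite cons_rV_mul.
- by apply: (measurableT_comp mF); exact: measurable_fun_mulmxrV.
Qed.

End slicing.

(** * Integration over the sphere by its two hemispheres *)

Section sphere_integral.
Context {R : realType} {n : nat}.
Local Notation V := 'rV[R]_n.+1.
Local Notation sphere := (@esphere R n.+1).
Local Open Scope ereal_scope.

Lemma measurable_esphere : measurable sphere.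
Proof.
have m : measurable_fun setT (fun z : V => enorm z).
  exact: measurable_fun_enorm.
by have := m measurableT [set 1%R] (measurable_set1 _); rewrite setTI.
Qed.

Lemma area_element_ge0 (w : 'rV[R]_n) : (0 <= area_element w)%R.
Proof. by rewrite invr_ge0 sqrtr_ge0. Qed.

Lemma measurable_area : measurable_fun setT (@area_element R n).
Proof.
apply: measurable_fun_inv; apply: measurable_fun_sqrt.
by apply: measurable_funB => //; exact: measurable_fun_dot.
Qed.

Lemma ge0_integral_area_measure (F : 'rV[R]_n -> \bar R) :
  measurable_fun setT F -> (forall w, 0 <= F w) ->
  \int[@area_measure R n]_w F w =
  \int[lebesgue_rV n]_w ((area_element w)%:E * F w).
Proof.
move=> mF F0; apply: (ge0_integral_transport _ _ _ _ _ _ _ (@area_element R n) id) => //.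
- exact: measurable_area.
- exact: area_element_ge0.
move=> A mA; rewrite /area_measure /= /area_measure integral_mkcond.
apply: eq_integral => w _; rewrite patchE indicE.
by case: ifP; rewrite ?mule1 ?mule0.
Qed.

Lemma dot_cons_rV (x : R) (w : 'rV[R]_n) :
  dot (cons_rV (x, w)) (cons_rV (x, w)) = (x ^+ 2 + dot w w)%R.
Proof.
rewrite !dotE big_ord_recl cons_rV0 -expr2; congr (_ + _)%R.
by apply: eq_bigr => i _; rewrite cons_rVS.
Qed.

Lemma esphere_cons_rV (s : R) (w : 'rV[R]_n) : (s ^+ 2 = 1)%R ->
  (dot w w < 1)%R -> esphere (cons_rV (s * Num.sqrt (1 - dot w w), w)%R).
Proof.
move=> s1 w1; rewrite /esphere /= /enorm dot_cons_rV exprMn s1 mul1r.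
by rewrite sqr_sqrtr ?subrK ?sqrtr1// subr_ge0 ltW.
Qed.

Lemma ge0_integral_sphere_measure (F : V -> \bar R) :
  measurable_fun setT F -> (forall e, 0 <= F e) ->
  \int[sphere_measure n]_(e in sphere) F e =
  \int[lebesgue_rV n]_w ((area_element w)%:E * F (upper_graph w)) +
  \int[lebesgue_rV n]_w ((area_element w)%:E * F (lower_graph w)).
Proof.
move=> mF F0; rewrite integral_mkcond.
have mFs : measurable_fun setT (F \_ sphere).
  apply/(measurable_restrictT _ _).1; first exact: measurable_esphere.
  exact: measurable_funTS.
have Fs0 e : 0 <= (F \_ sphere) e by rewrite patchE; case: ifPn.
have graph (g : 'rV[R]_n -> V) : measurable_fun setT g ->
    (forall w, dot w w < 1 -> sphere (g w))%R ->
    \int[@area_measure R n]_w (F \_ sphere) (g w) =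
    \int[lebesgue_rV n]_w ((area_element w)%:E * F (g w)).
  move=> mg g1; rewrite ge0_integral_area_measure//; last exact: measurableT_comp.
  apply: eq_integral => w _.
  have [w1|w1] := ltP (dot w w) 1%R; first by rewrite patchE mem_set//; exact: g1.
  (* Outside the open unit ball [g w] may leave the sphere, but there [area_element w] is the
     inverse of 0, that is, 0. *)
  by rewrite /area_element ler0_sqrtr ?subr_le0// invr0 !mul0e.
rewrite ge0_integral_measure_add//; congr (_ + _).
- rewrite ge0_integral_pushforward//; last exact: measurable_upper_graph.
  rewrite preimage_setT graph//; first exact: measurable_upper_graph.
  move=> w w1; have := esphere_cons_rV 1 w (expr1n _ 2) w1.
  by rewrite mul1r.
- rewrite ge0_integral_pushforward//; last exact: measurable_lower_graph.
  rewrite preimage_setT graph//; first exact: measurable_lower_graph.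
  move=> w w1; have := esphere_cons_rV (-1) w _ w1.
  by rewrite sqrrN expr1n mulN1r; exact.
Qed.

End sphere_integral.

(** * Polar coordinates *)

Section polar_coordinates.
Context {R : realType}.
Local Notation mu := (@lebesgue_measure R).
Local Open Scope ereal_scope.

Lemma ge0_integral_half_lines (f : R -> \bar R) :
  measurable_fun setT f -> (forall x, 0 <= f x) ->
  \int[mu]_(x in `]0%R, +oo[) f x + \int[mu]_(x in `]0%R, +oo[) f (- x)%R =
  \int[mu]_x f x.
Proof.
move=> mf f0.
have mfN : measurable_fun setT (fun x : R => f (- x)%R) by exact: measurableT_comp.
have -> : [set: measurableTypeR R] = `]-oo, 0%R] `|` `]0%R, +oo[.
  by rewrite -itv_bndbnd_setU ?set_itvNyy.
rewrite ge0_integral_setU//; last 2 first.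
- exact: measurable_funTS.
- apply/disj_setPS => x /=; rewrite !in_itv/= andbT => -[x0].
  by rewrite ltNge x0.
rewrite addeC; congr (_ + _).
rewrite integral_itv_obnd_cbnd; last exact: measurable_funTS.
rewrite (ge0_integration_by_substitution0 mfN)//.
by apply: eq_integral => x _; rewrite opprK.
Qed.

(** For [r = sqrt (x^2 + c)] the square root on the left is [x / r]: its inverse cancels the
    Jacobian [x / r], and the argument of [f] becomes [x]. In the application [c] is [|v|^2], so
    that [r] is the length of [(x, v)]. *)
Lemma ge0_integral_radial (c : R) (f : R -> \bar R) : (0 <= c)%R ->
  measurable_fun setT f -> (forall x, 0 <= f x) ->
  \int[mu]_(r in `]0%R, +oo[) (((Num.sqrt (1 - c / r ^+ 2))^-1)%:E *
    f (r * Num.sqrt (1 - c / r ^+ 2))%R) =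
  \int[mu]_(x in `]0%R, +oo[) f x.
Proof.
move=> c0 mf f0; have [->|cn0] := eqVneq c 0%R.
  by apply: eq_integral => r _; rewrite mul0r subr0 sqrtr1 invr1 mul1e mulr1.
have {cn0 c0}c0 : (0 < c)%R by rewrite lt_neqAle eq_sym cn0.
pose h (r : R) : R := Num.sqrt (1 - c / r ^+ 2).
have mh : measurable_fun setT h.
  apply: measurable_fun_sqrt; apply: measurable_funB => //.
  apply: measurable_funM => //; apply: measurable_fun_inv.
  exact: measurable_funX.
pose k r := ((h r)^-1)%:E * f (r * h r)%R.
have mk : measurable_fun setT k.
  apply: emeasurable_funM; first by apply/measurable_EFinP; exact: measurable_fun_inv.
  by apply: (measurableT_comp mf); exact: measurable_funM.
have k0 r : 0 <= k r by rewrite mule_ge0// lee_fin invr_ge0 sqrtr_ge0.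
transitivity (\int[mu]_(r in `]Num.sqrt c, +oo[) k r).
  rewrite integral_mkcond [RHS]integral_mkcond; apply: eq_integral => r _.
  rewrite !patchE !mem_setE !in_itv/= !andbT.
  have [cr|cr] := ltP (Num.sqrt c) r.
    by rewrite (le_lt_trans (sqrtr_ge0 c) cr).
  (* For [0 < r <= sqrt c] the square root of a nonpositive number is 0, and so is its inverse: the
     integrand vanishes. *)
  case: ifPn => // r0; rewrite ler0_sqrtr ?invr0 ?mul0e//.
  rewrite subr_le0 ler_pdivlMr ?exprn_gt0// mul1r -[leRHS]sqr_sqrtr ?(ltW c0)//.
  by rewrite lerXn2r// nnegrE ?sqrtr_ge0// ltW.
rewrite ge0_integral_sqrt_substitution//.
apply: eq_integral => x; rewrite inE/= in_itv/= andbT => x0.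
have x2c : (0 < x ^+ 2 + c)%R by rewrite ltr_wpDl// sqr_ge0.
set r := Num.sqrt (x ^+ 2 + c).
have r0 : (0 < r)%R by rewrite sqrtr_gt0.
have hr : h r = (x / r)%R.
  rewrite /h; have -> : (1 - c / r ^+ 2 = (x / r) ^+ 2)%R.
    rewrite expr_div_n (sqr_sqrtr (ltW x2c)); field.
    by rewrite gt_eqF.
  by rewrite sqrtr_sqr gtr0_norm// divr_gt0.
rewrite /k hr muleA -EFinM mulfV ?gt_eqF ?divr_gt0// mul1e mulrC divfK//.
by rewrite gt_eqF.
Qed.

Variable n : nat.
Local Notation V := 'rV[R]_n.+1.

(** The radial density, extended by zero so that the exchange of integrals takes place on the whole
    line. *)
Let pos_pow (r : R) : R := if (0 < r)%R then (r ^+ n)%R else 0%R.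

Let measurable_pos_pow : measurable_fun setT pos_pow.
Proof.
by apply: measurable_fun_ifT => //; exact: measurable_fun_ltr.
Qed.

Let pos_pow_ge0 r : (0 <= pos_pow r)%R.
Proof. by rewrite /pos_pow; case: ifPn => // r0; rewrite exprn_ge0// ltW. Qed.

Let pos_powE (f : R -> \bar R) : \int[mu]_r ((pos_pow r)%:E * f r) =
  \int[mu]_(r in `]0%R, +oo[) ((r ^+ n)%:E * f r).
Proof.
rewrite [RHS]integral_mkcond; apply: eq_integral => r _.
rewrite patchE mem_setE in_itv/= andbT /pos_pow.
by case: ifPn; rewrite ?mul0e.
Qed.

Lemma dotZ m (k : R) (v : 'rV[R]_m) : dot (k *: v) (k *: v) = (k ^+ 2 * dot v v)%R.
Proof.
by rewrite !dotE mulr_sumr; apply: eq_bigr => i _; rewrite !mxE; ring.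
Qed.

Lemma scale_cons_rV m (k x : R) (v : 'rV[R]_m) :
  (k *: cons_rV (x, v))%R = cons_rV (k * x, k *: v)%R.
Proof.
apply/rowP => i; rewrite mxE; case: (unliftP ord0 i) => [j ->|->].
  by rewrite !cons_rVS mxE.
by rewrite !cons_rV0.
Qed.

Lemma dot_ge0 m (v : 'rV[R]_m) : (0 <= dot v v)%R.
Proof. by rewrite dotE sumr_ge0// => i _; rewrite -expr2 sqr_ge0. Qed.

Let height (w : 'rV[R]_n) : R := Num.sqrt (1 - dot w w).

Let measurable_height d (T : measurableType d) (f : T -> 'rV[R]_n) :
  measurable_fun setT f -> measurable_fun setT (fun x => height (f x)).
Proof.
move=> mf; apply: measurable_fun_sqrt; apply: measurable_funB => //.
exact: measurable_fun_dot.
Qed.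

(* Fubini and the dilation v = r w turn the left-hand side into an integral in
   r for each v, on which r^2 = x^2 + |v|^2 is substituted. *)
Let graph_polar (s : R) (g : V -> \bar R) :
  measurable_fun setT g -> (forall v, 0 <= g v) ->
  \int[lebesgue_rV n]_w ((area_element w)%:E *
    \int[mu]_r ((pos_pow r)%:E * g (r *: cons_rV (s * height w, w))%R)) =
  \int[lebesgue_rV n]_v \int[mu]_(x in `]0%R, +oo[) g (cons_rV (s * x, v)%R).
Proof.
move=> mg g0.
pose G (w : 'rV[R]_n) (r : measurableTypeR R) : \bar R :=
  (area_element w)%:E * ((pos_pow r)%:E * g (r *: cons_rV (s * height w, w))%R).
have mG : measurable_fun setT (fun p : 'rV[R]_n * measurableTypeR R => G p.1 p.2).
  apply: emeasurable_funM.
    by apply/measurable_EFinP; apply: (measurableT_comp measurable_area).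
  apply: emeasurable_funM.
    by apply/measurable_EFinP; apply: (measurableT_comp measurable_pos_pow).
  apply: (measurableT_comp mg); apply: measurable_fun_scalerV => //.
  apply: measurable_fun_cons_rV => //; apply: measurable_funM => //.
  exact: measurable_height.
have G0 w r : 0 <= G w r by rewrite mule_ge0 ?mule_ge0 ?lee_fin ?area_element_ge0.
(* [H v r] is [G w r] at [w = r^-1 *: v], without the factor [r ^ n], which is the Jacobian of this
   dilation. *)
pose H (v : 'rV[R]_n) (r : measurableTypeR R) : \bar R :=
  (if (0 < r)%R then (area_element (r^-1 *: v)%R)%:E else 0) *
  g (cons_rV (s * (r * height (r^-1 *: v)), v))%R.
have mH : measurable_fun setT (fun p : 'rV[R]_n * measurableTypeR R => H p.1 p.2).
  have mrv : measurable_fun setT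
      (fun p : 'rV[R]_n * measurableTypeR R => (p.2^-1 *: p.1)%R).
    by apply: measurable_fun_scalerV => //; exact: measurable_fun_inv.
  apply: emeasurable_funM.
    apply: measurable_fun_ifT => //; first exact: measurable_fun_ltr.
    by apply/measurable_EFinP; apply: (measurableT_comp measurable_area).
  apply: (measurableT_comp mg); apply: measurable_fun_cons_rV => //.
  apply: measurable_funM => //; apply: measurable_funM => //.
  exact: measurable_height.
have H0 v r : 0 <= H v r.
  by rewrite mule_ge0//; case: ifPn => // _; rewrite lee_fin area_element_ge0.
transitivity (\int[lebesgue_rV n]_w \int[mu]_r G w r).
  apply: eq_integral => w _; rewrite -ge0_integralZl//.
  - apply: emeasurable_funM; first exact/measurable_EFinP.
    by apply: (measurableT_comp mg); exact: measurable_fun_scalerV.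
  - by move=> r _; rewrite mule_ge0// lee_fin.
  - by rewrite lee_fin area_element_ge0.
rewrite (ge0_exchange_integral _ _ _ _ _ _ mu G)//.
transitivity (\int[mu]_r \int[lebesgue_rV n]_v H v r).
  apply: eq_integral => r _; have [r0|r0] := ltP 0%R r; last first.
    rewrite !integral0_eq// => w _.
      by rewrite /H ltNge r0/= mul0e.
    by rewrite /G /pos_pow ltNge r0/= mul0e mule0.
  rewrite (@ge0_integral_rV_affine _ n r 0%R (H ^~ r))//.
    apply: eq_integral => w _; rewrite /G /H /pos_pow r0 addr0.
    rewrite scalerA mulVf ?gt_eqF// scale1r scale_cons_rV muleCA.
    by congr (_ * (_ * g (cons_rV (_, _)))); rewrite mulrCA.
  exact: (measurableT_comp mH (pair2_measurable r)).
rewrite -(ge0_exchange_integral _ _ _ _ _ _ mu H mH H0).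
clear mG mH.
apply: eq_integral => v _.
rewrite -(ge0_integral_radial (dot v v) (fun x => g (cons_rV (s * x, v)%R)))//.
- rewrite [RHS]integral_mkcond; apply: eq_integral => r _.
  rewrite patchE mem_setE in_itv/= andbT /H.
  case: ifPn => r0; last by rewrite mul0e.
  by rewrite /height /area_element dotZ exprVn mulrC.
- exact: dot_ge0.
- by apply: (measurableT_comp mg); exact: measurable_fun_cons_rV.
Qed.

(** The upper and lower hemispheres, [s = 1] and [s = -1], yield the integrals of [g] over the
    half-spaces where the first coordinate is positive and negative; the two add up to the integral
    over the whole space. *)
Lemma ge0_integral_polar (g : V -> \bar R) :
  measurable_fun setT g -> (forall v, 0 <= g v) ->
  \int[lebesgue_rV n.+1]_h g h =
  \int[sphere_measure n]_(e in @esphere R n.+1)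
    \int[mu]_(r in `]0%R, +oo[) ((r ^+ n)%:E * g (r *: e)%R).
Proof.
move=> mg g0.
under [RHS]eq_integral do rewrite -pos_powE.
have mF : measurable_fun setT
    (fun e : V => \int[mu]_r ((pos_pow r)%:E * g (r *: e)%R)).
  apply: (measurable_fun_integral_r _ _ _ _ _ mu
    (fun (e : V) (r : measurableTypeR R) => (pos_pow r)%:E * g (r *: e)%R)).
    apply: emeasurable_funM.
      by apply/measurable_EFinP; apply: (measurableT_comp measurable_pos_pow).
    by apply: (measurableT_comp mg); exact: measurable_fun_scalerV.
  by move=> e r; rewrite mule_ge0// lee_fin.
rewrite ge0_integral_sphere_measure//; last first.
  by move=> e; apply: integral_ge0 => r _; rewrite mule_ge0// lee_fin.
rewrite ge0_integral_rVS//.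
transitivity (
    \int[lebesgue_rV n]_v \int[mu]_(x in `]0%R, +oo[) g (cons_rV (1 * x, v)%R) +
    \int[lebesgue_rV n]_v \int[mu]_(x in `]0%R, +oo[)
      g (cons_rV (-1 * x, v)%R)); last first.
  congr (_ + _).
    rewrite -(graph_polar 1 g mg g0); apply: eq_integral => w _.
    by rewrite /upper_graph mul1r.
  rewrite -(graph_polar (-1) g mg g0); apply: eq_integral => w _.
  by rewrite /lower_graph mulN1r.
have mgs (s : R) : measurable_fun setT
    (fun p : 'rV[R]_n * measurableTypeR R => g (cons_rV (s * p.2, p.1)%R)).
  apply: (measurableT_comp mg); apply: measurable_fun_cons_rV => //.
  exact: measurable_funM.
have mgh (s : R) : measurable_fun setT (fun v : 'rV[R]_n =>
    \int[mu]_(x in `]0%R, +oo[) g (cons_rV (s * x, v)%R)).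
  rewrite (_ : (fun v => _) = fun v : 'rV[R]_n =>
      \int[mu]_x (if (0 < x)%R then g (cons_rV (s * x, v)%R) else 0)).
    apply: (measurable_fun_integral_r _ _ _ _ _ mu (fun v (x : measurableTypeR R) =>
      if (0 < x)%R then g (cons_rV (s * x, v)%R) else 0)).
      by apply: measurable_fun_ifT => //; exact: measurable_fun_ltr.
    by move=> v x; case: ifPn.
  apply/funext => v; rewrite integral_mkcond; apply: eq_integral => x _.
  by rewrite patchE mem_setE in_itv/= andbT.
rewrite -ge0_integralD//.
- apply: eq_integral => v _.
  rewrite -(ge0_integral_half_lines (fun x => g (cons_rV (x, v))))//; last first.
    by apply: (measurableT_comp mg); exact: measurable_fun_cons_rV.
  congr (_ + _); apply: eq_integral => x _; first by rewrite mul1r.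
  by rewrite mulN1r.
- by move=> v _; exact: integral_ge0.
- by move=> v _; exact: integral_ge0.
Qed.

End polar_coordinates.

(** * The energy of a Borel set of bonds *)

Section bond_energy.
Context {R : realType} (n : nat) (J : R -> R) (M eps : R).
Hypotheses (hJ : influence_function J M) (eps0 : 0 < eps).
Local Notation mu := (@lebesgue_measure R).
Local Notation V := 'rV[R]_n.+1.
Local Open Scope ereal_scope.

Let J_ge0 r : (0 <= r -> 0 <= J r)%R. Proof. by case: hJ => h _ _ _ _; exact: h. Qed.

Let J_eq0 r : (1 <= r -> J r = 0)%R. Proof. by case: hJ => _ _ _ _; exact. Qed.

(* J is only known to be monotone, hence measurable, on [0, +oo[. *)
Let Jmax (r : R) : R := J (Num.max 0%R r).

Let measurable_Jmax : measurable_fun setT Jmax.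
Proof.
apply: nonincreasing_measurable => // r s rs.
have [_ Jdec _ _ _] := hJ.
by apply: Jdec; [rewrite le_max lexx|rewrite ge_max !le_max lexx rs orbT].
Qed.

Let Jmax_ge0 r : (0 <= Jmax r)%R.
Proof. by apply: J_ge0; rewrite le_max lexx. Qed.

Let JmaxE r : (0 <= r)%R -> Jmax r = J r.
Proof. by move=> r0; rewrite /Jmax max_r. Qed.

(* The kernel times Cp, without the factor Cp / omega_d of the right-hand side. *)
Definition bond_weight (h : V) : R := ((eps ^+ n.+2)^-1 * J (enorm h / eps))%R.

Let enorm_ge0 (h : V) : (0 <= enorm h)%R. Proof. exact: sqrtr_ge0. Qed.

Lemma bond_weight_ge0 h : (0 <= bond_weight h)%R.
Proof.
rewrite mulr_ge0 ?invr_ge0 ?exprn_ge0 ?(ltW eps0)// J_ge0// divr_ge0//.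
exact: ltW.
Qed.

Lemma measurable_bond_weight : measurable_fun setT bond_weight.
Proof.
rewrite (_ : bond_weight =
    fun h => (eps ^+ n.+2)^-1 * Jmax (enorm h / eps))%R; last first.
  by apply/funext => h; rewrite JmaxE// divr_ge0// ltW.
apply: measurable_funM => //; apply: (measurableT_comp measurable_Jmax).
by apply: measurable_funM => //; exact: measurable_fun_enorm.
Qed.

Variable A : set (V * V).
Hypothesis mA : measurable A.

Let mA1 d (T : measurableType d) (f g : T -> V) : measurable_fun setT f ->
  measurable_fun setT g ->
  measurable_fun setT (fun x => (\1_A (f x, g x) : R)%:E).
Proof.
move=> mf mg; apply/measurable_EFinP.
apply: (measurableT_comp (measurable_indic mA)) => //.
exact: measurable_fun_pair.
Qed.

Let I (h : V) : \bar R := \int[lebesgue_rV n.+1]_x (\1_A (x, x + h)%R)%:E.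

Let I_ge0 h : 0 <= I h. Proof. by apply: integral_ge0 => x _; rewrite lee_fin. Qed.

Let measurable_I : measurable_fun setT I.
Proof.
apply: (measurable_fun_integral_l _ _ _ _ _ _
  (fun x h : V => (\1_A (x, x + h)%R)%:E)) => //.
by apply: mA1 => //; exact: measurable_fun_addrV.
Qed.

Lemma bond_energy_differences :
  \int[lebesgue_rV n.+1]_x \int[lebesgue_rV n.+1]_y
    (bond_weight (y - x)%R * \1_A (x, y))%:E =
  \int[lebesgue_rV n.+1]_h ((bond_weight h)%:E * I h).
Proof.
have mw : measurable_fun setT
    (fun p : V * V => (bond_weight p.2)%:E * (\1_A (p.1, p.1 + p.2)%R)%:E).
  apply: emeasurable_funM.
    by apply/measurable_EFinP; apply: (measurableT_comp measurable_bond_weight).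
  by apply: mA1 => //; exact: measurable_fun_addrV.
transitivity (\int[lebesgue_rV n.+1]_x \int[lebesgue_rV n.+1]_h
    ((bond_weight h)%:E * (\1_A (x, x + h)%R)%:E)).
  apply: eq_integral => x _.
  rewrite (ge0_integral_rV_translation _ x (fun y =>
    (bond_weight (y - x)%R * \1_A (x, y))%:E)).
  - by apply: eq_integral => h _; rewrite addrK EFinM addrC.
  - apply/measurable_EFinP; apply: measurable_funM.
      apply: (measurableT_comp measurable_bond_weight).
      exact: measurable_fun_addrV.
    by apply/measurable_EFinP; exact: mA1.
  - by move=> y; rewrite lee_fin mulr_ge0// bond_weight_ge0.
rewrite (ge0_exchange_integral _ _ _ _ _ _ _ (fun x h : V =>
  (bond_weight h)%:E * (\1_A (x, x + h)%R)%:E)) //; last first.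
  by move=> x h; rewrite -EFinM lee_fin mulr_ge0// bond_weight_ge0.
apply: eq_integral => h _; rewrite ge0_integralZl//.
- by apply: mA1 => //; exact: measurable_fun_addrV.
- by rewrite lee_fin bond_weight_ge0.
Qed.

(** The weight [J q * q ^ n.+1] with the factor [1 / (eps * q)] of the multiplicity absorbed. Since
    [J] vanishes from 1 on, the integral over [[0, 1]] becomes one over the line; at [q = 0] the
    power of [q] makes both expressions 0. *)
Let beta (q : R) : R :=
  if (0 < q)%R then (Jmax q * q ^+ n.+1 / (eps * q))%R else 0%R.

Let beta_ge0 q : (0 <= beta q)%R.
Proof.
rewrite /beta; case: ifPn => // q0.
by rewrite !mulr_ge0 ?invr_ge0 ?mulr_ge0 ?exprn_ge0 ?(ltW eps0) ?(ltW q0).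
Qed.

Let measurable_beta : measurable_fun setT beta.
Proof.
apply: measurable_fun_ifT => //; first exact: measurable_fun_ltr.
apply: measurable_funM; first exact: measurable_funM.
by apply: measurable_fun_inv; exact: measurable_funM.
Qed.

Let betaE (q : R) (f : \bar R) : q \in `[0%R, 1%R] ->
  (J q * q ^+ n.+1)%:E * (((eps * q)^-1)%:E * f) = (beta q)%:E * f.
Proof.
rewrite in_itv/= => /andP[q0 q1]; rewrite muleA -EFinM /beta.
move: q0; rewrite le_eqVlt => /predU1P[<-|q0].
  by rewrite ltxx exprS mul0r mulr0 mul0r.
by rewrite q0 JmaxE// ltW.
Qed.

Let beta_eq0 (q : R) : q \notin `[0%R, 1%R] -> beta q = 0%R.
Proof.
rewrite in_itv/= negb_and -!ltNge => /orP[q0|q1]; rewrite /beta.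
  by rewrite ltNge (ltW q0).
by rewrite (lt_trans _ q1)// JmaxE ?J_eq0 ?mul0r// ltW// (lt_trans _ q1).
Qed.

(** The substitution [r = eps * q] brings a factor [eps], and [r ^ n] gives [eps ^ n * q ^ n].
    Divided by the [eps ^ n.+2] of the bond weight, there remains [q ^ n / eps], that is,
    [q ^ n.+1 / (eps * q)]. *)
Let radial (e : V) : esphere e ->
  \int[mu]_(r in `]0%R, +oo[)
    ((r ^+ n)%:E * ((bond_weight (r *: e)%R)%:E * I (r *: e)%R)) =
  \int[mu]_q ((beta q)%:E * I ((eps * q) *: e)%R).
Proof.
move=> e1; pose F (r : R) : \bar R := if (0 < r)%R then
  (r ^+ n)%:E * ((bond_weight (r *: e)%R)%:E * I (r *: e)%R) else 0.
have mre : measurable_fun setT (fun r : R => (r *: e)%R).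
  exact: measurable_fun_scalerV.
transitivity (\int[mu]_r F r).
  rewrite integral_mkcond; apply: eq_integral => r _.
  by rewrite patchE mem_setE in_itv/= andbT.
rewrite (ge0_integral_lebesgue_affine eps 0%R F)//.
- apply: eq_integral => q _; rewrite addr0 /F /beta pmulr_rgt0//.
  case: ifPn => q0; last by rewrite mule0 mul0e.
  rewrite !muleA -!EFinM /bond_weight; congr (_%:E * _).
  have -> : enorm ((eps * q) *: e) = (eps * q)%R.
    rewrite /enorm dotZ sqrtrM ?sqr_ge0// -/(enorm e) (_ : enorm e = 1%R)//.
    by rewrite mulr1 sqrtr_sqr gtr0_norm// mulr_gt0.
  rewrite JmaxE ?ltW// [(eps * q)%R]mulrC mulfK ?gt_eqF// exprMn !exprS.
  by field; rewrite !gt_eqF ?exprn_gt0.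
- apply: measurable_fun_ifT => //; first exact: measurable_fun_ltr.
  apply: emeasurable_funM; first by apply/measurable_EFinP; exact: measurable_funX.
  apply: emeasurable_funM; last exact: (measurableT_comp measurable_I).
  by apply/measurable_EFinP; apply: (measurableT_comp measurable_bond_weight).
- move=> r; rewrite /F; case: ifPn => // r0.
  by rewrite !mule_ge0// lee_fin ?bond_weight_ge0 ?exprn_ge0// ltW.
Qed.

Let sliced (e : V) : esphere e ->
  \int[lebesgue_perp e]_(z in perp e) \int[mu]_(q in `[0%R, 1%R])
    ((J q * q ^+ n.+1)%:E * (((eps * q)^-1)%:E *
      \int[mu]_s (\1_A (z + s *: e, z + (s + eps * q) *: e)%R)%:E)) =
  \int[mu]_q ((beta q)%:E * I ((eps * q) *: e)%R).
Proof.
move=> e1.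
pose K (z : V) (q : measurableTypeR R) : \bar R :=
  \int[mu]_s (\1_A (z + s *: e, z + (s + eps * q) *: e)%R)%:E.
have K0 z q : 0 <= K z q by apply: integral_ge0 => s _; rewrite lee_fin.
have mK : measurable_fun setT (fun p : V * measurableTypeR R => K p.1 p.2).
  apply: (measurable_fun_integral_r _ _ _ _ _ mu
    (fun (p : V * measurableTypeR R) (s : measurableTypeR R) =>
      (\1_A (p.1 + s *: e, p.1 + (s + eps * p.2) *: e)%R)%:E)) => [|p s]; last first.
    by rewrite lee_fin.
  have mz : measurable_fun setT
    (fun p : (V * measurableTypeR R) * measurableTypeR R => p.1.1).
    exact: (measurableT_comp measurable_fst).
  have mq : measurable_fun setT
    (fun p : (V * measurableTypeR R) * measurableTypeR R => p.1.2).
    exact: (measurableT_comp measurable_snd).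
  apply: mA1; apply: measurable_fun_addrV => //; apply: measurable_fun_scalerV => //.
  by apply: measurable_funD => //; exact: measurable_funM.
have mbK : measurable_fun setT
    (fun p : V * measurableTypeR R => (beta p.2)%:E * K p.1 p.2).
  apply: emeasurable_funM => //; apply/measurable_EFinP.
  by apply: (measurableT_comp measurable_beta).
transitivity (\int[lebesgue_perp e]_(z in perp e) \int[mu]_q ((beta q)%:E * K z q)).
  apply: eq_integral => z _; rewrite integral_mkcond; apply: eq_integral => q _.
  rewrite patchE mem_setE; case: ifPn => q01; first by rewrite betaE.
  by rewrite beta_eq0// mul0e.
(* The hyperplane is parametrized by [lebesgue_rV n], whose sigma-finiteness allows the exchange
   with the integral in [q]. For fixed [q], slicing applies to the indicator of the points [x] with
   [(x, x + (eps * q) *: e)] in [A]. *)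
rewrite ge0_integral_lebesgue_perp//; last 2 first.
- apply: (measurable_fun_integral_r _ _ _ _ _ mu
    (fun (z : V) (q : measurableTypeR R) => (beta q)%:E * K z q)) => // z q.
  by rewrite mule_ge0// lee_fin.
- by move=> z; apply: integral_ge0 => q _; rewrite mule_ge0// lee_fin.
have mwB : measurable_fun setT (fun w : 'rV[R]_n => w *m perp_frame e).
  exact: measurable_fun_mulmxrV.
rewrite (ge0_exchange_integral _ _ _ _ _ _ mu (fun (w : 'rV[R]_n)
  (q : measurableTypeR R) => (beta q)%:E * K (w *m perp_frame e) q)); last 2 first.
- apply: (measurableT_comp mbK
    (g := fun p : 'rV[R]_n * measurableTypeR R => (p.1 *m perp_frame e, p.2))).
  by apply: measurable_fun_pair => //; exact: (measurableT_comp mwB).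
- by move=> w q; rewrite mule_ge0// lee_fin.
apply: eq_integral => q _.
have mKq : measurable_fun setT (K ^~ q).
  exact: (measurableT_comp mK (pair2_measurable q)).
rewrite ge0_integralZl ?lee_fin//; last exact: (measurableT_comp mKq).
congr (_ * _).
rewrite -(ge0_integral_lebesgue_perp e (K ^~ q))//.
have mIq : measurable_fun setT
    (fun x : V => (\1_A (x, x + (eps * q) *: e)%R : R)%:E).
  by apply: mA1; [exact: measurable_id|exact: measurable_fun_addrV].
rewrite /I -(ge0_integral_slices e _ e1 mIq); last by move=> x; rewrite lee_fin.
apply: eq_integral => z _; apply: eq_integral => s _.
by rewrite scalerDl addrA.
Qed.

Lemma bond_energy_slices :
  \int[lebesgue_rV n.+1]_x \int[lebesgue_rV n.+1]_y
    (bond_weight (y - x)%R * \1_A (x, y))%:E =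
  \int[sphere_measure n]_(e in @esphere R n.+1)
    \int[lebesgue_perp e]_(z in perp e) \int[mu]_(q in `[0%R, 1%R])
    ((J q * q ^+ n.+1)%:E * (((eps * q)^-1)%:E *
      \int[mu]_s (\1_A (z + s *: e, z + (s + eps * q) *: e)%R)%:E)).
Proof.
rewrite bond_energy_differences ge0_integral_polar.
- by apply: eq_integral => e; rewrite inE => e1; rewrite radial// sliced.
- apply: emeasurable_funM => //; apply/measurable_EFinP.
  exact: measurable_bond_weight.
- by move=> h; rewrite mule_ge0// lee_fin bond_weight_ge0.
Qed.

End bond_energy.

(** * The energy of the failure set *)

Section sandwich.
Context {R : realType} (n : nat) (J : R -> R) (M eps : R).
Hypotheses (hJ : influence_function J M) (eps0 : 0 < eps).
Local Notation V := 'rV[R]_n.+1.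
Local Notation mu2 := (lebesgue_rV n.+1 \x lebesgue_rV n.+1)%E.
Local Open Scope ereal_scope.

Let weight_indic (A : set (V * V)) (p : V * V) : R :=
  (bond_weight n J eps (p.2 - p.1) * \1_A p)%R.

Let weight_indic_ge0 A p : (0 <= weight_indic A p)%R.
Proof. by rewrite mulr_ge0// (bond_weight_ge0 _ _ _ _ hJ eps0). Qed.

Let measurable_weight_indic A : measurable A -> measurable_fun setT (weight_indic A).
Proof.
move=> mA; apply: measurable_funM; last exact: measurable_indic.
apply: (measurableT_comp (measurable_bond_weight _ _ _ _ hJ eps0)).
apply: measurable_fun_addrV => //.
rewrite (_ : (fun x => _) = fun p : V * V => (- 1) *: p.1)%R.
  exact: measurable_fun_scalerV.
by apply/funext => p; rewrite scaleN1r.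
Qed.

(** As an integral for the product measure, the energy visibly ignores null sets of pairs. The
    factor [k] will be [Cp / ball_volume n.+1], or 1. *)
Lemma bond_energy_prod (k : R) A : (0 <= k)%R -> measurable A ->
  \int[lebesgue_rV n.+1]_x \int[lebesgue_rV n.+1]_y
    (k * (bond_weight n J eps (y - x) * \1_A (x, y)))%:E =
  k%:E * \int[mu2]_p (bond_weight n J eps (p.2 - p.1)%R * \1_A p)%:E.
Proof.
move=> k0 mA.
have mw : measurable_fun setT (EFin \o weight_indic A).
  by apply/measurable_EFinP; exact: measurable_weight_indic.
transitivity (\int[mu2]_p (k * weight_indic A p)%:E).
  rewrite (fubini_tonelli1 (fun p => (k * weight_indic A p)%:E))//.
  - exact: (measurable_funeM k%:E mw).
  - by move=> p; rewrite lee_fin mulr_ge0// weight_indic_ge0.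
under eq_integral do rewrite EFinM.
rewrite ge0_integralZl ?lee_fin// => p _.
by rewrite lee_fin weight_indic_ge0.
Qed.

Lemma bond_energy_setU_null A N : measurable A -> measurable N -> mu2 N = 0 ->
  \int[mu2]_p (bond_weight n J eps (p.2 - p.1)%R * \1_(A `|` N) p)%:E =
  \int[mu2]_p (bond_weight n J eps (p.2 - p.1)%R * \1_A p)%:E.
Proof.
move=> mA mN N0; apply: ge0_ae_eq_integral => //.
- apply/measurable_EFinP; apply: (measurable_weight_indic (A `|` N)).
  exact: measurableU.
- by apply/measurable_EFinP; exact: (measurable_weight_indic A).
- by move=> p _; rewrite lee_fin weight_indic_ge0.
- by move=> p _; rewrite lee_fin weight_indic_ge0.
exists N; split => // p /= h; apply: contrapT => Np; apply: h => _.
congr (_ * _)%:E; rewrite !indicE; congr (nat_of_bool _)%:R.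
by apply/idP/idP; rewrite !inE; [move=> [//|/Np]|left].
Qed.

End sandwich.

(** The zero set of [gamma] in [Omega x Omega] is a Borel set up to a part of a Borel null set, and
    the condition [|y - x| < eps] is Borel. The failure set evaluates [gamma] at the swapped pair,
    which symmetry undoes. *)
Lemma failure_set_completed (R : realType) (n : nat)
    (Omega : set 'rV[R]_n.+1) (eps T t : R)
    (gamma : 'rV[R]_n.+1 -> 'rV[R]_n.+1 -> R -> R) :
  degradation_factor Omega T gamma -> 0 <= t -> t <= T ->
  exists A N, [/\ measurable A, measurable N,
    (lebesgue_rV n.+1 \x lebesgue_rV n.+1)%E N = 0%E,
    A `<=` failure_set Omega eps gamma t &
    failure_set Omega eps gamma t `<=` A `|` N].
Proof.
move=> hgamma t0 tT; have [mgamma _ sgamma] := hgamma t t0 tT.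
have [A1 mA1 [N1 [N [mN N0 N1N]] A1N1]] := mgamma [set 0] (measurable_set1 _).
pose D : set ('rV[R]_n.+1 * 'rV[R]_n.+1) := [set p | enorm (p.2 - p.1) < eps].
have mD : measurable D.
  have md : measurable_fun setT
      (fun p : 'rV[R]_n.+1 * 'rV[R]_n.+1 => enorm (p.2 + (-1) *: p.1)).
    apply: measurable_fun_enorm; apply: measurable_fun_addrV => //.
    exact: measurable_fun_scalerV.
  rewrite -[D]setTI (_ : D = (fun p => enorm (p.2 + (-1) *: p.1)) @^-1`
      `]-oo, eps[%classic); first exact: md.
  by apply/seteqP; split => p; rewrite /D /= in_itv/= scaleN1r.
have FSE p : failure_set Omega eps gamma t p <->
    ((A1 `|` N1) p /\ D p).
  rewrite A1N1 /failure_set /eball /D /=; split.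
    by move=> [x1 [[x2 pe] g0]]; rewrite sgamma.
  by move=> [[[x1 x2] g0] pe]; rewrite sgamma.
exists (A1 `&` D), N; split => //.
- exact: measurableI.
- by move=> p [A1p Dp]; apply/FSE; split => //; left.
- move=> p /FSE[[A1p|N1p] Dp]; [by left|right; exact: N1N].
Qed.

Theorem mainTheorem6 (R : realType) (n : nat)
    (hd : n.+1 = 2%N \/ n.+1 = 3%N)
    (Omega : set 'rV[R]_n.+1) (hOmega : bounded_domain Omega)
    (eps : R) (heps : 0 < eps) (Cp : R) (hCp : 0 < Cp)
    (J : R -> R) (M : R) (hJ : influence_function J M)
    (T : R) (gamma : 'rV[R]_n.+1 -> 'rV[R]_n.+1 -> R -> R)
    (hgamma : degradation_factor Omega T gamma)
    (t : R) (ht0 : 0 <= t) (htT : t <= T) :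
  failure_energy Omega J eps Cp gamma t =
  ((Cp / ball_volume n.+1)%:E *
    \int[sphere_measure n]_(e in esphere (n := n.+1))
      \int[lebesgue_perp e]_(z in shadow Omega e)
        \int[lebesgue_measure]_(q in `[0%R, 1%R])
          ((J q * q ^+ n.+1)%:E * slice_multiplicity Omega eps gamma t e z q))%E.
Proof.
have [A [N [mA mN N0 AFS FSAN]]] := failure_set_completed _ _ _ eps _ _ _ hgamma ht0 htT.
have mAN : measurable (A `|` N) by exact: measurableU.
pose FS := failure_set Omega eps gamma t.
have FSO x y : FS (x, y) -> Omega x /\ Omega y by case=> /= Ox [[Oy _] _].
have ind_le (B C : set ('rV[R]_n.+1 * 'rV[R]_n.+1)) p : B `<=` C ->
    (\1_B p <= \1_C p :> R)%R.
  move=> BC; rewrite !indicE ler_nat.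
  by case: (boolP (p \in B)) => // /[!inE]/BC h; rewrite mem_set.
have ind_out x y : ~ (Omega x /\ Omega y) -> \1_A (x, y) = 0 :> R.
  by move=> nO; rewrite indicE memNset// => /AFS/FSO.
pose C := Cp / ball_volume n.+1.
have w0 : 0 < ball_volume n.+1 :> R.
  apply: fine_gt0; rewrite lebesgue_unit_ball_gt0 /=.
  exact: lebesgue_unit_ball_lty.
have C0 : 0 <= C by rewrite divr_ge0// ltW.
have kernelE x y : Defs.kernel Omega J eps y x * Cp * failed Omega eps gamma y x t =
    C * (bond_weight n J eps (y - x) * \1_FS (x, y)).
  rewrite /failed -/FS [\1_FS _]indicE; case: (boolP (_ \in _)) => [|_].
    rewrite inE => /FSO[_ Oy]; rewrite /Defs.kernel /bond_weight /C.
    rewrite [\1_Omega _]indicE mem_set// !mulr1 mul1r !exprS.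
    by field; rewrite !gt_eqF ?exprn_gt0.
  by rewrite !mulr0.
have Cw0 x y B : 0 <= C * (bond_weight n J eps (y - x) * \1_B (x, y)).
  by apply: mulr_ge0 => //; apply: mulr_ge0 => //; exact: bond_weight_ge0 hJ heps _.
have Cw_le x y B D : B `<=` D -> C * (bond_weight n J eps (y - x) * \1_B (x, y)) <=
    C * (bond_weight n J eps (y - x) * \1_D (x, y)).
  move=> BD; apply: ler_wpM2l => //; apply: ler_wpM2l; last exact: ind_le.
  exact: bond_weight_ge0 hJ heps _.
pose E0 B := (\int[(lebesgue_rV n.+1 \x lebesgue_rV n.+1)%E]_p
  (bond_weight n J eps (p.2 - p.1)%R * \1_B p)%:E)%E.
have EAN : E0 (A `|` N) = E0 A.
  exact: (bond_energy_setU_null _ _ _ _ hJ heps).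
(* Squeeze between the energies of [A] and of [A] with [N]. The lower bound extends the domain from
   [Omega] to the whole space at no cost, because [A] lies in [Omega x Omega]. *)
have -> : failure_energy Omega J eps Cp gamma t = (C%:E * E0 A)%E.
  rewrite /failure_energy; apply/le_anti/andP; split.
    rewrite -EAN -(bond_energy_prod _ _ _ _ hJ heps)//.
    apply: ge0_le_lower_integral_subset => //.
    - by move=> x _; apply: integral_ge0 => y _; rewrite lee_fin kernelE.
    - by move=> x _; apply: integral_ge0 => y _; rewrite lee_fin.
    move=> x Ox; apply: ge0_le_lower_integral_subset => //.
    - by move=> y _; rewrite lee_fin kernelE.
    - by move=> y _; rewrite lee_fin.
    by move=> y Oy; rewrite lee_fin kernelE Cw_le.
  rewrite /E0 -(bond_energy_prod _ _ _ _ hJ heps)//.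
  apply: ge0_le_lower_integral_dom.
  - by move=> x _; apply: integral_ge0 => y _; rewrite lee_fin.
  - by move=> x _; apply: integral_ge0 => y _; rewrite lee_fin kernelE.
  - move=> x _ Ox; apply: ge0_le_lower_integral_dom.
    + by move=> y _; rewrite lee_fin.
    + by move=> y _; rewrite lee_fin kernelE.
    + by move=> y _ Oy; rewrite lee_fin kernelE Cw_le.
    + by move=> y _ Oy; rewrite ind_out ?mulr0// => -[].
  - move=> x _ Ox; apply: integral0_eq => y _.
    by rewrite ind_out ?mulr0// => -[].
congr (_ * _)%E.
pose E1 B := (\int[sphere_measure n]_(e in esphere (n := n.+1))
    \int[lebesgue_perp e]_(z in perp e) \int[lebesgue_measure]_(q in `[0%R, 1%R])
    ((J q * q ^+ n.+1)%:E * (((eps * q)^-1)%:E * \int[lebesgue_measure]_s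
      (\1_B (z + s *: e, z + (s + eps * q) *: e)%R)%:E)))%E.
have E01 B : measurable B -> E0 B = E1 B.
  move=> mB; rewrite /E1 -(bond_energy_slices _ _ _ _ hJ heps)//.
  rewrite -[LHS]mul1e -(bond_energy_prod _ _ _ _ hJ heps 1 B ler01 mB).
  by apply: eq_integral => x _; apply: eq_integral => y _; rewrite mul1r.
have EA : E0 A = E1 A by exact: E01.
(* [N] may meet particular lines in positive length; that [E1] does not see it is inferred from
   [E0]. *)
have EA' : E0 A = E1 (A `|` N) by rewrite -EAN; exact: E01.
clear EAN E01; clearbody E0.
have J0 q : `[0%R, 1%R]%classic q -> (0 <= (J q * q ^+ n.+1)%:E)%E.
  rewrite /= in_itv/= => /andP[q0 _]; rewrite lee_fin mulr_ge0 ?exprn_ge0//.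
  by case: hJ => h _ _ _ _; exact: h.
have eq0 q : `[0%R, 1%R]%classic q -> (0 <= ((eps * q)^-1)%:E)%E.
  rewrite /= in_itv/= => /andP[q0 _].
  by rewrite lee_fin invr_ge0 mulr_ge0// ltW.
have s0 e z q B D : (0 <= \int[lebesgue_measure]_(s in D)
    (\1_B (z + s *: e, z + (s + eps * q) *: e) : R)%:E)%E.
  by apply: integral_ge0 => s _; rewrite lee_fin.
have m0 e z q B D : `[0%R, 1%R]%classic q -> (0 <=
    (J q * q ^+ n.+1)%:E * (((eps * q)^-1)%:E * \int[lebesgue_measure]_(s in D)
      (\1_B (z + s *: e, z + (s + eps * q) *: e)%R)%:E))%E.
  by move=> q01; apply: mule_ge0; [exact: J0|apply: mule_ge0; [exact: eq0|]].
have q0 e z B D : (0 <= \int[lebesgue_measure]_(q in `[0%R, 1%R])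
    ((J q * q ^+ n.+1)%:E * (((eps * q)^-1)%:E * \int[lebesgue_measure]_(s in D)
      (\1_B (z + s *: e, z + (s + eps * q) *: e)%R)%:E)))%E.
  by apply: integral_ge0 => q q01; exact: m0.
rewrite /slice_multiplicity /failed -/FS.
apply/le_anti/andP; split.
  (* Lower bound: the bonds of [A] have both ends in [Omega], so nothing is lost when the hyperplane
     is cut down to the shadow and the line to its slice. *)
  rewrite EA /E1; apply: ge0_le_lower_integral_subset; first exact: subset_refl.
  - by move=> e _; apply: integral_ge0 => z _; exact: q0.
  - by move=> e _; apply: integral_ge0 => z _; exact: q0.
  move=> e e1; apply: ge0_le_lower_integral_dom.
  - by move=> z _; exact: q0.
  - by move=> z _; exact: q0.
  - move=> z _ _; apply: ge0_le_lower_integral_subset; first exact: subset_refl.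
    + by move=> q q01; exact: m0.
    + by move=> q q01; exact: m0.
    move=> q q01; rewrite lee_wpmul2l ?J0// lee_wpmul2l ?eq0//.
    apply: ge0_le_lower_integral_dom.
    + by move=> s _; rewrite lee_fin.
    + by move=> s _; rewrite lee_fin.
    + by move=> s _ _; rewrite lee_fin ind_le.
    + by move=> s _ ns; rewrite ind_out// => -[].
  - move=> z ze nz; apply: integral0_eq => q _.
    rewrite integral0_eq ?mule0// => s _.
    rewrite ind_out// => -[Os _]; apply: nz; split => //.
    by exists s.
(* Upper bound: shadow and slice are enlarged to the hyperplane and the line, and the failure set to
   [A] with [N], whose sliced integral is no larger than that of [A]. *)
rewrite EA' /E1; apply: ge0_le_lower_integral_subset; first exact: subset_refl.
- by move=> e _; apply: integral_ge0 => z _; exact: q0.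
- by move=> e _; apply: integral_ge0 => z _; exact: q0.
move=> e e1; apply: ge0_le_lower_integral_subset.
- by move=> z [].
- by move=> z _; exact: q0.
- by move=> z _; exact: q0.
- move=> z _; apply: ge0_le_lower_integral_subset; first exact: subset_refl.
  + by move=> q q01; exact: m0.
  + by move=> q q01; exact: m0.
  move=> q q01; rewrite lee_wpmul2l ?J0// lee_wpmul2l ?eq0//.
  apply: ge0_le_lower_integral_subset; first exact: subsetT.
  + by move=> s _; rewrite lee_fin.
  + by move=> s _; rewrite lee_fin.
  + by move=> s _; rewrite lee_fin ind_le.
Qed.
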